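(* There exists $\gamma>0$ such that for any $p=p(n)<1.1/n$ (with $p\in[0,1]$), the random graph $G\sim G(n,p)$ satisfies the following with high probability (i.e. with probability tending to $1$ as $n\to\infty$): for every subset $V'\subseteq[n]$ of size $|V'|\ge\gamma\log n$, the induced subgraph $G[V']$ is not globally rigid in $\mathbb{R}$.
   Context: $G(n,p)$ is the Erdős–Rényi random graph on the vertex set $[n]=\{1,\dots,n\}$, in which each pair of vertices is an edge independently with probability $p$. $\log$ denotes the natural logarithm. Global rigidity in $\mathbb{R}$ (injective version): a simple graph $H=(V,E)$ is globally rigid in $\mathbb{R}$ if for every two injective functions $f,g:V\to\mathbb{R}$ satisfying $|f(x)-f(y)|=|g(x)-g(y)|$ for every edge $xy\in E$, we also have $|f(x)-f(y)|=|g(x)-g(y)|$ for every pair $x,y\in V$. *)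

(* Defs.v *)
From HB Require Import structures.
From mathcomp Require Import all_boot all_order all_algebra.
From mathcomp Require Import all_classical all_reals all_analysis.

Set Implicit Arguments.
Unset Strict Implicit.
Unset Printing Implicit Defensive.

Import Order.TTheory GRing.Theory Num.Theory.
Import numFieldNormedType.Exports.

Local Open Scope ring_scope.

Definition pairs (V : finType) : {set {set V}} := [set e : {set V} | #|e| == 2].

Record sgraph (V : finType) := SGraph {
  edges :> {set {set V}};
  edges_pairs : edges \subset pairs V }.

HB.instance Definition _ (V : finType) := [isSub for @edges V].
HB.instance Definition _ (V : finType) := [Finite of sgraph V by <:].

Definition adj (V : finType) (G : sgraph V) : rel V :=
  fun x y => [set x; y] \in edges G.

Lemma adj_sym (V : finType) (G : sgraph V) : symmetric (adj G).
Proof. by move=> x y; rewrite /adj finset.setUC. Qed.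

Lemma adj_irrefl (V : finType) (G : sgraph V) : irreflexive (adj G).
Proof.
move=> x; apply/negP => /(fintype.subsetP (edges_pairs G)).
by rewrite inE finset.setUid cards1.
Qed.

Section Induced.
Variables (V : finType) (G : sgraph V) (S : {set V}).

Definition induced_edges : {set {set {x | x \in S}}} :=
  [set e : {set {x | x \in S}} | [set val x | x in e]%SET \in edges G].

Lemma induced_edges_pairs : induced_edges \subset pairs {x | x \in S}.
Proof.
apply/fintype.subsetP => e; rewrite inE => /(fintype.subsetP (edges_pairs G)).
by rewrite !inE card_imset //; exact: val_inj.
Qed.

Definition induced_subgraph : sgraph {x | x \in S} := SGraph induced_edges_pairs.

Lemma adj_induced (x y : {x | x \in S}) :
  adj induced_subgraph x y = adj G (val x) (val y).
Proof. by rewrite /adj inE imsetU1 imset_set1. Qed.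

End Induced.

Definition globally_rigid (R : realType) (V : finType) (H : sgraph V) : Prop :=
  forall f g : V -> R, injective f -> injective g ->
    (forall x y, adj H x y -> `|f x - f y| = `|g x - g y|) ->
    forall x y, `|f x - f y| = `|g x - g y|.

(* The law of G(n, p) on labelled graphs is the product over all pairs of
   vertices of Bernoulli(p) laws; see [gnp_pr_total] and [gnp_pr_superset]. *)
Definition gnp_weight (R : realType) (n : nat) (p : R) (G : sgraph 'I_n) : R :=
  \prod_(e in pairs 'I_n) (if e \in edges G then p else 1 - p).

Definition gnp_pr (R : realType) (n : nat) (p : R)
    (A : sgraph 'I_n -> Prop) : R :=
  \sum_(G : sgraph 'I_n | `[< A G >]) gnp_weight p G.

Lemma sum_sgraph_prod (R : realType) (V : finType) (F H : {set V} -> R) :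
  \sum_(G : sgraph V) \prod_(e in pairs V) (if e \in edges G then F e else H e)
  = \prod_(e in pairs V) (F e + H e).
Proof.
pose F' e := if e \in pairs V then F e else 0.
pose H' e := if e \in pairs V then H e else 1.
transitivity (\prod_e (F' e + H' e)); last first.
  rewrite [RHS]big_mkcond; apply: eq_bigr => e _.
  by rewrite /F' /H'; case: ifP => // _; rewrite add0r.
rewrite bigA_distr (bigID (fun E : {set {set V}} => E \subset pairs V)) /=.
rewrite [X in _ = _ + X]big1 ?addr0 => [|E /subsetPn[e eE eP]]; last first.
  by rewrite (bigD1 e) //= eE /F' (negPf eP) mul0r.
rewrite (reindex_omap (@edges V) insub) => [|E EP]; last by rewrite insubT.
apply: eq_big => [G|G _].
  rewrite edges_pairs; symmetry; apply/eqP; exact: (valK G).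
rewrite big_mkcond; apply: eq_bigr => e _; rewrite /F' /H'.
case: ifP => // eP; case: ifP => // /(fintype.subsetP (edges_pairs G)).
by rewrite eP.
Qed.

Lemma gnp_pr_total (R : realType) (n : nat) (p : R) :
  gnp_pr p (fun _ : sgraph 'I_n => True) = 1.
Proof.
rewrite /gnp_pr (eq_bigl xpredT) => [|G]; last by apply/asboolP.
by rewrite sum_sgraph_prod big1 // => e _; rewrite addrC subrK.
Qed.

Lemma gnp_pr_superset (R : realType) (n : nat) (p : R)
    (S : {set {set 'I_n}}) : S \subset pairs 'I_n ->
  gnp_pr p (fun G : sgraph 'I_n => S \subset edges G) = p ^+ #|S|.
Proof.
move=> SP; pose H e := if e \in S then 0 else 1 - p.
transitivity (\prod_(e in pairs 'I_n) (p + H e)).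
  rewrite -(sum_sgraph_prod (fun=> p)) /gnp_pr.
  rewrite [RHS](bigID (fun G : sgraph 'I_n => S \subset edges G)) /=.
  rewrite [X in _ = _ + X]big1 ?addr0 => [|G /subsetPn[e eS eG]]; last first.
    rewrite (bigD1 e) /=; last exact: (fintype.subsetP SP).
    by rewrite (negPf eG) /H eS mul0r.
  apply: eq_big => [G|G /asboolP SG]; first by rewrite asboolb.
  apply: eq_bigr => e _; case: ifP => // eG; rewrite /H.
  by case: ifP => // /(fintype.subsetP SG); rewrite eG.
rewrite (big_setID S) /= (finset.setIidPr SP).
rewrite [X in _ * X]big1 ?mulr1 => [|e]; last first.
  by rewrite inE /H => /andP[/negPf-> _]; rewrite addrC subrK.
rewrite -prodr_const; apply: eq_bigr => e eS; by rewrite /H eS addr0.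
Qed.

(* Main.v *)
(** Write H = G[V'], and suppose H is globally rigid with at least 4 vertices.
Reflecting one side of a cut vertex, or swapping the first and the last step
of a bare path with three edges, shows that H has minimum degree at least 2 and
that its vertices of degree 2 form an independent set A.  Let B be the
remaining vertices, and call "link" an edge inside B or a path x-u-y with u in
A; if there are M links, then |V'| <= 5M/3.  Ordering and orienting the links
gives 2^M M! words of length 2M over B in which every letter occurs at least
three times.  The expected number of such words is controlled by the
exponential generating function e^y - 1 - y - y^2/2, and is at most
2^M M! e M e^(-0.076 M) provided |B| <= n/9.  As M >= 90 log n, a union bound
over M suffices.  Finally |B| <= n/9 holds with high probability, since about
0.0996 n vertices of G have degree at least 3; this is proved by counting
j-sets of such vertices for a large constant j. *)
From HB Require Import structures.
Require Import Defs.
From mathcomp Require Import all_boot all_order all_algebra.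
From mathcomp Require Import all_classical all_reals all_analysis.
From mathcomp Require Import perm ring lra zify.
Import Order.TTheory GRing.Theory Num.Theory.
Import numFieldNormedType.Exports.
Local Open Scope ring_scope.

(** * Global rigidity and low degrees *)

Section Rigidity.
Context {R : realType} {V : finType}.
Implicit Types (H : sgraph V) (u v w a b : V) (S : {set V}).

Let pos v : R := (enum_rank v).+1%:R.

Let pos_gt0 v : 0 < pos v. Proof. by rewrite ltr0n. Qed.

Let pos_inj : injective pos.
Proof.
by move=> v w /eqP; rewrite eqr_nat => /eqP[] /ord_inj; apply: enum_rank_inj.
Qed.

Let pos_le v : pos v <= #|V|%:R.
Proof. by rewrite ler_nat ltn_ord. Qed.

(* Put [a] at the origin and everything else on the positive axis; then reflect
   [S] through the origin. *)
Lemma cut_vertex_not_rigid H S a u w :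
  u \in S -> a \notin S -> w \notin S -> w != a ->
  (forall x y, x \in S -> adj H x y -> y \in a |: S) ->
  ~ globally_rigid R H.
Proof.
move=> uS aS wS wa clS.
pose f v := if v == a then 0 else pos v.
pose g v := if v \in S then - f v else f v.
have f_ge0 v : 0 <= f v by rewrite /f; case: ifP => // _; apply: ltW.
have f_gt0 v : v != a -> 0 < f v by rewrite /f => /negPf->.
have f_inj : injective f.
  move=> x y; rewrite /f; case: eqP => [->|_]; case: eqP => [->|_] //.
  - by move/eqP; rewrite lt_eqF.
  - by move/eqP; rewrite gt_eqF.
  - exact: pos_inj.
have Sa x : x \in S -> x != a by apply: contraTneq => ->.
have g_inj : injective g.
  move=> x y; rewrite /g; case: ifP => xS; case: ifP => yS.
  - by move/oppr_inj/f_inj.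
  - by move=> e; have := f_gt0 _ (Sa _ xS); rewrite -oppr_lt0 e ltNge f_ge0.
  - by move=> e; have := f_gt0 _ (Sa _ yS); rewrite -oppr_lt0 -e ltNge f_ge0.
  - exact: f_inj.
have fa : f a = 0 by rewrite /f eqxx.
move=> /(_ f g f_inj g_inj) rig.
have : `|f u - f w| = `|g u - g w|.
  apply: rig => x y xy; rewrite /g.
  have yx : adj H y x by rewrite adj_sym.
  case: ifP => xS; case: ifP => yS //.
  - by rewrite -opprD normrN.
  - by have := clS _ _ xS xy; rewrite !inE yS orbF => /eqP->; rewrite fa !subr0 normrN.
  - by have := clS _ _ yS yx; rewrite !inE xS orbF => /eqP->; rewrite fa opprK sub0r add0r normrN.
rewrite /g uS (negPf wS) -opprD normrN.
have fu := f_gt0 _ (Sa _ uS); have fw := f_gt0 _ wa.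
rewrite (ger0_norm (addr_ge0 (ltW fu) (ltW fw))).
by move: fu fw; clear; case: ger0P; lra.
Qed.

(* Put [a, b, u, v] at [0, 1, s, s + 1] with [s] large; then replace [s] by
   [- s]: the vectors [au] and [vb] are opposite, so the flip keeps all three
   edge lengths. *)
Lemma bare_path_not_rigid H a u v b :
  uniq [:: a; u; v; b] ->
  (forall x, adj H u x -> x \in [:: a; v]) ->
  (forall x, adj H v x -> x \in [:: u; b]) ->
  ~ globally_rigid R H.
Proof.
rewrite /= !inE !negb_or -!andbA => /and5P[au av ab uv /and3P[ub vb _]] Nu Nv.
(* This size puts [s] and [s + 1] beyond every [pos x + 1], and puts [- s] and [- s + 1] below zero,
   so both placements are injective. *)
pose s : R := #|V|%:R + 2.
have s_pos x : pos x + 2 <= s by rewrite lerD2r.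
pose h (t : R) x := if x == a then 0 else if x == b then 1 else
  if x == u then t else if x == v then t + 1 else pos x + 1.
have h_inj t : (t = s \/ t = - s) -> injective (h t).
  clear -s_pos pos_gt0 pos_inj.
  move=> ts x y; have := s_pos x; have := s_pos y.
  have := pos_gt0 x; have := pos_gt0 y; have := @pos_inj x y.
  rewrite /h; do 8?[case: eqP => [->|_]] => //; case: ts => ts; rewrite ?ts.
  all: try solve [move=> inj p1 p2 s1 s2 e; exfalso; lra].
  all: try solve [move=> inj p1 p2 s1 s2 e; apply: inj; move: e; clear; lra].
have ha t : h t a = 0 by rewrite /h eqxx.
have hb t : h t b = 1 by rewrite /h eq_sym (negPf ab) eqxx.
have hu t : h t u = t by rewrite /h eq_sym (negPf au) (negPf ub) eqxx.
have hv t : h t v = t + 1.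
  by rewrite /h eq_sym (negPf av) (negPf vb) (eq_sym v u) (negPf uv) eqxx.
have ho x : x != u -> x != v -> h (- s) x = h s x.
  by rewrite /h => /negPf-> /negPf->.
have edge_u x : adj H u x -> `|h s u - h s x| = `|h (- s) u - h (- s) x|.
  move/Nu; rewrite !inE => /orP[] /eqP->; rewrite ?ha ?hu ?hv ?subr0 ?normrN //.
  by congr `|_|; lra.
have edge_v x : adj H v x -> `|h s v - h s x| = `|h (- s) v - h (- s) x|.
  move/Nv; rewrite !inE => /orP[] /eqP->; rewrite ?hb ?hu ?hv.
    by congr `|_|; lra.
  by rewrite !addrK normrN.
move=> /(_ (h s) (h (- s)) (h_inj _ _) (h_inj _ _)) rig.
have s_ge2 : 2 <= s by rewrite lerDr.
have : `|h s u - h s b| = `|h (- s) u - h (- s) b|.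
  apply: rig; [by left|by right|] => x y xy.
  have yx : adj H y x by rewrite adj_sym.
  have [xu|xu] := eqVneq x u; first by rewrite xu in xy *; apply: edge_u.
  have [xv|xv] := eqVneq x v; first by rewrite xv in xy *; apply: edge_v.
  have [yu|yu] := eqVneq y u.
    by rewrite yu in yx *; rewrite distrC [RHS]distrC; apply: edge_u.
  have [yv|yv] := eqVneq y v.
    by rewrite yv in yx *; rewrite distrC [RHS]distrC; apply: edge_v.
  by rewrite !ho.
rewrite !hu !hb -opprD normrN !ger0_norm; lra.
Qed.

Definition nbrs H v : {set V} := [set w | adj H v w].

(** A vertex with at most one neighbour [a] is separated by [a] from any third vertex, so the
    reflection argument applies to [[set v]]. For an isolated vertex any other vertex can play the
    part of [a]. *)
Lemma rigid_min_degree H v :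
  (3 <= #|V|)%N -> globally_rigid R H -> (2 <= #|nbrs H v|)%N.
Proof.
move=> V3 rig; rewrite leqNgt; apply/negP => dv.
have [a av Na] : exists2 a, a != v & forall y, adj H v y -> y = a.
  have [N0|[a aN]] := set_0Vmem (nbrs H v).
    have /card_gt0P[a] : (0 < #|~: [set v]|)%N by have := cardsC1 v; lia.
    rewrite !inE => av; exists a => // y vy.
    have yN : y \in nbrs H v by rewrite inE.
    by rewrite N0 inE in yN.
  exists a => [|y vy].
    by apply: contraTneq aN => ->; rewrite inE adj_irrefl.
  have /card_le1_eqP le1 : (#|nbrs H v| <= 1)%N by [].
  by apply: le1; rewrite // inE.
have /card_gt0P[w] : (0 < #|~: [set v; a]|)%N.
  by have := cardsC [set v; a]; have := cards2 v a; case: (v != a); lia.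
rewrite !inE negb_or => /andP[wv wa].
apply: (@cut_vertex_not_rigid H [set v] a v w) rig; rewrite ?inE //.
by move=> x y /set1P-> /Na->; rewrite !inE eqxx.
Qed.

(** Let [a] and [b] be the other neighbours of [u] and [v]. If they differ, [a]-[u]-[v]-[b] is a
    bare path; if they agree, [a] separates [[set u; v]] from a fourth vertex. *)
Lemma rigid_degree2_indep H u v :
  (4 <= #|V|)%N -> globally_rigid R H -> adj H u v ->
  #|nbrs H u| = 2 -> #|nbrs H v| = 2 -> False.
Proof.
move=> V4 rig uv du dv.
have vu : adj H v u by rewrite adj_sym.
have other x y : adj H x y -> #|nbrs H x| = 2 ->
    exists2 a, a != y & forall z, adj H x z = (z \in [:: a; y]).
  move=> xy /eqP/cards2P[a [b [ab E]]].
  have yE : y \in nbrs H x by rewrite inE.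
  have Nx z : adj H x z = (z \in [:: a; b]).
    transitivity (z \in nbrs H x); first by rewrite inE.
    by rewrite E !inE.
  rewrite E !inE in yE; case/orP: yE => /eqP->; last by exists a.
  by exists b; rewrite 1?eq_sym // => z; rewrite Nx !inE orbC.
have [a av Nu] := other u v uv du; have [b bu Nv] := other v u vu dv.
have neq x y : adj H x y -> x != y by apply: contraTneq => ->; rewrite adj_irrefl.
have ua : adj H u a by rewrite Nu !inE eqxx.
have vb : adj H v b by rewrite Nv !inE eqxx.
have [ab|ab] := eqVneq a b; last first.
  apply: (@bare_path_not_rigid H a u v b _ _ _ rig) => [|x|x].
  - by rewrite /= !inE !negb_or av ab (neq _ _ uv) (neq _ _ vb) (eq_sym u b) bu
      (eq_sym a u) (neq _ _ ua).
  - by rewrite Nu.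
  - by rewrite Nv !inE orbC.
have /card_gt0P[w] : (0 < #|~: [set a; u; v]|)%N.
  have := cardsC [set a; u; v]; have := cardsU1 a [set u; v].
  have := cards2 u v; rewrite finset.setUA; case: (u != v); case: (_ \notin _); lia.
rewrite !inE !negb_or -andbA => /and3P[wa wu wv].
apply: (@cut_vertex_not_rigid H [set u; v] a u w) rig;
  rewrite ?inE ?eqxx ?negb_or ?av ?wu ?wv ?(eq_sym a u) ?(neq _ _ ua) //.
move=> x y; rewrite !inE => /orP[] /eqP->.
  by rewrite Nu !inE => /orP[]->; rewrite ?orbT.
by rewrite Nv -ab !inE => /orP[]->; rewrite ?orbT.
Qed.

End Rigidity.

(** * Union bounds in the random graph *)

Section RandomGraph.
Context {R : realType} {n : nat}.
Implicit Types (p : R) (G : sgraph 'I_n) (A B : sgraph 'I_n -> Prop).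

Lemma gnp_weight_ge0 p G : 0 <= p <= 1 -> 0 <= gnp_weight p G.
Proof.
move=> /andP[p0 p1]; apply: prodr_ge0 => e _; case: ifP => // _.
by rewrite subr_ge0.
Qed.

Lemma gnp_pr_ge0 p A : 0 <= p <= 1 -> 0 <= gnp_pr p A.
Proof. by move=> p01; apply: sumr_ge0 => G _; apply: gnp_weight_ge0. Qed.

(** Markov's inequality for the number of indices [t] in [D] whose event [P t] occurs; the
    right-hand side is its expectation. *)
Lemma gnp_pr_markov (T : finType) (D : pred T) (P : T -> sgraph 'I_n -> Prop)
    A (c : nat) p : 0 <= p <= 1 ->
  (forall G, A G -> (c <= #|[set t | D t & `[< P t G >]]|)%N) ->
  c%:R * gnp_pr p A <= \sum_(t | D t) gnp_pr p (P t).
Proof.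
move=> p01 cP; rewrite /gnp_pr mulr_sumr.
rewrite (exchange_big_dep xpredT) //= [leLHS]big_mkcond.
apply: ler_sum => G _; case: ifPn => [/asboolP/cP cG|_]; last first.
  by apply: sumr_ge0 => t _; apply: gnp_weight_ge0.
rewrite sumr_const -[leRHS]mulr_natl ler_wpM2r ?gnp_weight_ge0 // ler_nat.
by apply: leq_trans cG _; rewrite cardsE.
Qed.

Lemma gnp_pr_union (T : finType) (D : pred T) (P : T -> sgraph 'I_n -> Prop)
    A p : 0 <= p <= 1 ->
  (forall G, A G -> exists2 t, D t & P t G) ->
  gnp_pr p A <= \sum_(t | D t) gnp_pr p (P t).
Proof.
move=> p01 AP; rewrite -[leLHS]mul1r -[1]/(1%:R); apply: gnp_pr_markov => // G.
move=> /AP[t Dt Pt]; apply/card_gt0P; exists t.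
by rewrite inE Dt; apply/asboolP.
Qed.

Lemma gnp_pr_le A B p : 0 <= p <= 1 -> (forall G, A G -> B G) ->
  gnp_pr p A <= gnp_pr p B.
Proof.
move=> p01 AB; have := gnp_pr_union _ xpredT (fun _ : unit => B) A p p01.
rewrite (big_pred1 tt) => [|[]] //; apply=> G /AB BG.
by exists tt.
Qed.

Lemma gnp_prC p A : gnp_pr p A = 1 - gnp_pr p (fun G => ~ A G).
Proof.
rewrite -(gnp_pr_total n p); apply/eqP; rewrite eq_sym subr_eq; apply/eqP.
rewrite /gnp_pr (bigID (fun G => `[< A G >])) /=; congr (_ + _).
  by apply: eq_bigl => G; rewrite (asboolT I).
by apply: eq_bigl => G; rewrite (asboolT I) asbool_neg.
Qed.

(** The modified weights [F] and [H] vanish exactly where a graph disagrees with [S] on [D], so the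
    sum over all graphs factorizes over pairs. *)
Lemma gnp_pr_pattern p (D S : {set {set 'I_n}}) :
  D \subset pairs 'I_n -> S \subset D ->
  gnp_pr p (fun G => edges G :&: D = S)%SET = p ^+ #|S| * (1 - p) ^+ #|D :\: S|.
Proof.
move=> DP SD.
pose F e := if e \in D :\: S then 0 else p.
pose H e := if e \in S then 0 else 1 - p.
transitivity (\prod_(e in pairs 'I_n) (F e + H e)).
  rewrite -sum_sgraph_prod /gnp_pr.
  rewrite [RHS](bigID (fun G : sgraph 'I_n => (edges G :&: D == S)%SET)) /=.
  rewrite [X in _ = _ + X]big1 ?addr0 => [|G]; last first.
    move=> /eqP/setP/existsNP[e]; rewrite finset.in_setI => eGDS.
    have eD : e \in D.
      apply: contrapT => /negP eD; apply: eGDS; rewrite (negPf eD) andbF.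
      by apply/esym/negbTE; apply: contra eD; exact: (fintype.subsetP SD).
    rewrite (bigD1 e) /=; last exact: (fintype.subsetP DP).
    move: eGDS; rewrite eD andbT /F /H finset.in_setD eD andbT.
    by case: (e \in S); case: (e \in edges G); rewrite /= ?mul0r.
  apply: eq_big => [G|G /asboolP/setP GDS].
    by apply/asboolP/eqP.
  apply: eq_bigr => e _; have := GDS e.
  rewrite /F /H finset.in_setI finset.in_setD.
  case: (boolP (e \in D)) => [_|eD]; first by rewrite andbT => ->; case: (e \in S).
  by rewrite andbF andbF => <-.
rewrite (big_setID D) /= (finset.setIidPr DP) (big_setID S) /= (finset.setIidPr SD).
rewrite [X in _ * X]big1 ?mulr1 => [|e]; last first.
  rewrite /F /H !finset.in_setD => /andP[/negPf eD _]; rewrite eD andbF.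
  case: ifP => [/(fintype.subsetP SD)|_]; first by rewrite eD.
  by rewrite addrC subrK.
rewrite -!prodr_const; congr (_ * _); apply: eq_bigr => e.
  by move=> eS; rewrite /F /H finset.in_setD eS addr0.
rewrite /F /H => eDS; rewrite eDS add0r.
by move: eDS; rewrite finset.in_setD => /andP[/negPf-> _].
Qed.

End RandomGraph.

(** * Estimates on the exponential and the factorial *)

Section Exponential.
Context {R : realType}.
Implicit Types (x y : R).

Lemma exp_partial_sum_le x L : 0 <= x -> \sum_(d < L) x ^+ d / d`!%:R <= expR x.
Proof.
move=> x0; have -> : \sum_(d < L) x ^+ d / d`!%:R = series (exp_coeff x) L.
  by rewrite /series /= big_mkord.
apply: nondecreasing_cvgn_le (is_cvg_series_exp_coeff x) L.
apply/nondecreasing_series => k _ _; rewrite /exp_coeff /=.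
by rewrite divr_ge0 ?exprn_ge0.
Qed.

Lemma expR_le_of_partial_sums x b :
  (forall L, \sum_(d < L) x ^+ d / d`!%:R <= b) -> expR x <= b.
Proof.
move=> xb; apply: limr_le; first exact: is_cvg_series_exp_coeff.
by near=> L; rewrite /series /= big_mkord; apply: xb.
Unshelve. all: by end_near. Qed.

(** Group the terms of degrees [2j + 3] and [2j + 4] of the exponential series. Raising [j] by one
    multiplies these factorials by at least [20 (j + 1)], with equality for the first one at [j = 0]
    (4 times 5), so the groups are dominated by the series of [expR (y ^+ 2 / 20)]. *)
Lemma expR_tail3_le y : 0 <= y ->
  expR y - 1 - y - y ^+ 2 / 2 <= (y ^+ 3 / 6 + y ^+ 4 / 24) * expR (y ^+ 2 / 20).
Proof.
move=> y0; set E := expR (_ / 20).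
suff : expR y <= 1 + y + y ^+ 2 / 2 + (y ^+ 3 / 6 + y ^+ 4 / 24) * E by lra.
apply: expR_le_of_partial_sums => L.
have fact_le j : (6 * 20 ^ j * j`! <= (j.*2 + 3)`!)%N /\
    (24 * 20 ^ j * j`! <= (j.*2 + 4)`!)%N.
  elim: j => // j [IH3 IH4]; rewrite doubleS !addSn !factS expnS.
  have e c a b d1 d2 : (c * 20 ^ j * a <= b -> 20 * j.+1 <= d1 * d2 ->
      c * (20 * 20 ^ j) * (j.+1 * a) <= d1 * (d2 * b))%N.
    move=> h1 h2; rewrite (_ : (_ * (_ * _) = (20 * j.+1) * (c * 20 ^ j * a))%N).
      by rewrite [leqRHS]mulnA leq_mul.
    by ring.
  by split; apply: e => //; nia.
have term_le k m c j : (c%:R != 0 :> R) -> (c * 20 ^ j * j`! <= m`!)%N ->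
    m = (j.*2 + k)%N ->
    y ^+ m / m`!%:R <= y ^+ k / c%:R * ((y ^+ 2 / 20) ^+ j / j`!%:R).
  move=> c0 le_fact me; rewrite me -mul2n in le_fact *; rewrite exprD exprM expr_div_n.
  set z := _ ^+ j; rewrite (_ : _ * (z / _ / _) = z * y ^+ k / (c * 20 ^ j * j`!)%:R).
    have c_gt0 : (0 < c * 20 ^ j * j`!)%N.
      by rewrite !muln_gt0 fact_gt0 expn_gt0 andbT lt0n -(pnatr_eq0 R) c0.
    rewrite ler_wpM2l ?mulr_ge0 ?exprn_ge0 //.
    by rewrite lef_pV2 ?posrE ?ltr0n ?fact_gt0 // ler_nat.
  rewrite !natrM natrX; field; rewrite c0 expf_neq0 ?pnatr_eq0 //.
  by rewrite -lt0n fact_gt0.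
have even_sum K : \sum_(d < K.*2 + 3) y ^+ d / d`!%:R <= 1 + y + y ^+ 2 / 2 +
    (y ^+ 3 / 6 + y ^+ 4 / 24) * \sum_(j < K) (y ^+ 2 / 20) ^+ j / j`!%:R.
  elim: K => [|K IH].
    rewrite !big_ord_recr !big_ord0 /= !fact0 /=.
    by rewrite expr0 expr1 mulr0 addr0 add0r !divr1.
  have [f3 f4] := fact_le K.
  have := @term_le 3%N (K.*2 + 3)%N 6%N K _ f3 (erefl _).
  have := @term_le 4%N (K.*2 + 4)%N 24%N K _ f4 (erefl _).
  rewrite !pnatr_eq0 => /(_ isT) t4 /(_ isT) t3.
  rewrite [in leRHS]big_ord_recr doubleS !addSn [leLHS]big_ord_recr /=.
  rewrite [X in X + _]big_ord_recr /= -(addnS _ 3).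
  move: IH t3 t4; set a := \sum_(_ < _) _; set b := \sum_(_ < _) _.
  set t := _ ^+ K / _; move: (y ^+ (_ + 3) / _) (y ^+ (_ + 4) / _) => t3 t4.
  by clear; nra.
apply: le_trans (_ : \sum_(d < L.*2 + 3) y ^+ d / d`!%:R <= _); last first.
  apply: le_trans (even_sum L) _; rewrite lerD2l ler_wpM2l //.
    by rewrite addr_ge0 ?divr_ge0 ?exprn_ge0.
  by apply: exp_partial_sum_le; rewrite divr_ge0 ?exprn_ge0.
rewrite -[leRHS](big_mkord xpredT (fun d => y ^+ d / d`!%:R)).
rewrite (@big_cat_nat _ _ _ L) //=; last by lia.
rewrite big_mkord lerDl sumr_ge0 // => i _; rewrite divr_ge0 ?exprn_ge0 //.
Qed.

(** Induction on [m]; the step reduces to [1 - 1/k <= expR (- 1/k)] raised to the power [k], with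
    [k = m.+2]. *)
Lemma fact_le_stirling (m : nat) : (0 < m)%N ->
  m`!%:R <= expR 1 * m%:R * (m%:R ^+ m * expR (- m%:R)) :> R.
Proof.
case: m => // m _; elim: m => [|m IH].
  by rewrite expr1 mulr1 mul1r -expRD subrr expR0.
rewrite factS natrM; apply: le_trans (ler_wpM2l _ IH) _; first by rewrite ler0n.
have step : m.+1%:R ^+ m.+2 * expR 1 <= m.+2%:R ^+ m.+2 :> R.
  have m2 : 0 < m.+2%:R :> R by rewrite ltr0n.
  rewrite -ler_pdivlMr ?expR_gt0 // -expRN -ler_pdivrMl ?exprn_gt0 //.
  rewrite mulrC -expr_div_n (_ : expR (- 1) = expR (- m.+2%:R^-1) ^+ m.+2).
    rewrite lerXn2r ?nnegrE ?divr_ge0 ?expR_ge0 ?ler0n //.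
    apply: le_trans (expR_ge1Dx _); rewrite ler_pdivrMr // mulrDl mul1r mulNr.
    by rewrite mulVf ?lt0r_neq0 // -[in leRHS]natr1 addrK.
  by rewrite -expRM_natl mulrN divff ?lt0r_neq0.
rewrite [in leLHS]exprSr in step.
have e1 : expR (- m.+1%:R) = expR 1 * expR (- m.+2%:R) :> R.
  by rewrite -expRD; congr expR; rewrite -[m.+2%:R]natr1; lra.
rewrite e1.
have -> : m.+2%:R * (expR 1 * m.+1%:R * (m.+1%:R ^+ m.+1 * (expR 1 * expR (- m.+2%:R))))
  = (expR 1 * m.+2%:R * expR (- m.+2%:R)) * (m.+1%:R ^+ m.+1 * m.+1%:R * expR 1) :> R.
  by ring.
apply: le_trans (ler_wpM2l _ step) _; last by rewrite le_eqVlt; apply/orP; left; apply/eqP; ring.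
by rewrite !mulr_ge0 ?expR_ge0.
Qed.

Lemma fact_double_le (m : nat) : (m.*2`! <= 4 ^ m * m`! ^ 2)%N.
Proof.
elim: m => // m IH; rewrite doubleS !factS expnS.
by move: IH; move: (_`!) (_`!) (4 ^ m)%N => a b c; nia.
Qed.

End Exponential.

(** * Words with prescribed letter multiplicities *)

Section Words.
Context {R : realType} {I V : finType}.
Variables (phi : nat -> R) (y : R).
Hypotheses (phi_ge0 : forall d, 0 <= phi d) (y_gt0 : 0 < y).

Let egf N : R := \sum_(d < N.+1) phi d * y ^+ d / d`!%:R.

Let egf_ge0 N : 0 <= egf N.
Proof.
by apply: sumr_ge0 => d _; rewrite divr_ge0 ?mulr_ge0 ?exprn_ge0 // ltW.
Qed.

Lemma sum_subsets_card (S : {set I}) (f : nat -> R) :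
  \sum_(D : {set I} | D \subset S) f #|D| = \sum_(d < #|S|.+1) 'C(#|S|, d)%:R * f d.
Proof.
rewrite (partition_big (fun D : {set I} => inord #|D| : 'I_#|S|.+1) xpredT) //=.
apply: eq_bigr => d _; rewrite -cards_draws mulr_natl -sumr_const.
apply: eq_big => [D|D /andP[DS /eqP <-]]; last first.
  by rewrite inordK // ltnS subset_leq_card.
rewrite inE; case DS: (D \subset S) => //=.
by rewrite -[inord _ == _]val_eqE /= inordK // ltnS subset_leq_card.
Qed.

(* Words are only free on the positions in [S], where they use the letters of
   [us]; outside [S] they agree with [c0].  The induction on [us] then needs no
   bijection: choosing the positions [D] of the first letter amounts to
   extending [c0] to [D]. *)
Lemma sum_words_aux N (us : seq V) (S : {set I}) (c0 : {ffun I -> V}) :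
  uniq us -> (#|S| <= N)%N ->
  \sum_(c : {ffun I -> V} | [forall i, if i \in S then c i \in us else c i == c0 i])
     \prod_(v <- us) phi #|[set i in S | c i == v]|
  <= (#|S|)`!%:R / y ^+ #|S| * egf N ^+ size us.
Proof.
elim: us S c0 => [|u us IH] S c0 /=.
  move=> _ _; have [->|[i iS]] := set_0Vmem S; last first.
    rewrite big1 => [|c /forallP/(_ i)]; last by rewrite iS.
    by rewrite expr0 mulr1 divr_ge0 // exprn_ge0 // ltW.
  rewrite cards0 !expr0 !mulr1 invr1 (big_pred1 c0) => [|c]; first by rewrite big_nil fact0 mulr1.
  apply/forallP/eqP => [cE|-> i]; last by rewrite inE.
  by apply/ffunP => i; have := cE i; rewrite inE => /eqP.
move=> /andP[u_us us_uniq] SN.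
rewrite (partition_big (fun c : {ffun I -> V} => [set i in S | c i == u])
  (fun D => D \subset S)) /= => [|c _]; last first.
  by apply/fintype.subsetP => i; rewrite inE => /andP[].
apply: le_trans (_ : \sum_(D : {set I} | D \subset S)
    phi #|D| * ((#|S| - #|D|)`!%:R / y ^+ (#|S| - #|D|) * egf N ^+ size us) <= _).
  apply: ler_sum => D DS.
  have cardSD : #|S :\: D| = (#|S| - #|D|)%N by rewrite cardsD (finset.setIidPr DS).
  pose c1 := [ffun i => if i \in D then u else c0 i].
  have := IH (S :\: D) c1 us_uniq (_ : _ <= N)%N; rewrite cardSD.
  move=> /(_ (leq_trans (leq_subr _ _) SN)) IHD.
  apply: le_trans (ler_wpM2l (phi_ge0 #|D|) IHD); rewrite mulr_sumr.
  rewrite [leLHS]big_mkcond [leRHS]big_mkcond; apply: ler_sum => c _.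
  case: ifP => [/andP[/forallP cS /eqP cD]|_]; last first.
    case: ifP => _; last exact: lexx.
    apply: mulr_ge0; first exact: phi_ge0.
    by apply: prodr_ge0 => v _; apply: phi_ge0.
  have cDE i : (i \in D) = (i \in S) && (c i == u) by rewrite -cD inE.
  rewrite ifT; last first.
    apply/forallP => i; rewrite finset.in_setD cDE ffunE cDE.
    have := cS i; case: (i \in S) => /=; rewrite ?andbF //.
    by rewrite inE; case: eqVneq => [->|_] /=; rewrite ?eqxx.
  rewrite big_cons cD ler_wpM2l // le_eqVlt; apply/orP; left; apply/eqP.
  apply: eq_big_seq => v vus; congr (phi #|pred_of_set _|).
  apply/setP => i; rewrite !inE cDE; case: (i \in S); rewrite ?andbF //=.
  have [->|_] /= := eqVneq (c i) u; last by [].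
  by rewrite ?andbF; apply/negbTE; apply: contraNneq u_us => ->.
rewrite (sum_subsets_card S (fun d =>
  phi d * ((#|S| - d)`!%:R / y ^+ (#|S| - d) * egf N ^+ size us))).
rewrite exprS mulrA (_ : \sum_(d < _) _ =
  (#|S|)`!%:R / y ^+ #|S| * egf #|S| * egf N ^+ size us).
  rewrite ler_wpM2r ?exprn_ge0 // ler_wpM2l ?divr_ge0 ?exprn_ge0 ?(ltW y_gt0) //.
  rewrite /egf -!(big_mkord xpredT (fun d => phi d * y ^+ d / d`!%:R)).
  rewrite [leRHS](@big_cat_nat _ _ _ #|S|.+1) //= lerDl sumr_ge0 // => d _.
  by rewrite divr_ge0 ?mulr_ge0 ?exprn_ge0 // ltW.
rewrite mulr_sumr mulr_suml; apply: eq_bigr => d _.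
have dS : (d <= #|S|)%N by rewrite -ltnS.
rewrite -[in RHS](bin_fact dS) -[in y ^+ #|S|](subnK dS) exprD !natrM.
field; rewrite !expf_neq0 ?lt0r_neq0 //=.
Qed.

(** The left-hand side is [#|I|!] times the coefficient of degree [#|I|] in the [#|V|]-th power of
    the exponential generating function of [phi]. A coefficient of a series with nonnegative terms
    is at most its value at [y] divided by the power of [y]. *)
Lemma sum_words :
  \sum_(c : {ffun I -> V}) \prod_v phi #|[set i | c i == v]|
  <= (#|I|)`!%:R / y ^+ #|I| * egf #|I| ^+ #|V|.
Proof.
(* A letter is needed to build the constant word [c0], which is irrelevant once all positions are
   free; the empty alphabet is treated apart. *)
have [v0 _|V0] := pickP (pred_of_simpl (@predT V)); last first.
  have [i _|I0] := pickP (pred_of_simpl (@predT I)).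
    rewrite big1 => [|c]; last by have := V0 (c i).
    by rewrite mulr_ge0 ?divr_ge0 ?exprn_ge0 // ltW.
  rewrite (eq_card0 I0) (eq_card0 V0) !expr0 !mulr1 invr1.
  apply: le_trans (_ : \sum_(c : {ffun I -> V}) 1 <= _).
    by apply: ler_sum => c _; rewrite big_pred0.
  by rewrite sumr_const card_ffun (eq_card0 I0) expn0 fact0 mulr1.
have := @sum_words_aux #|I| (enum V) [set: I] [ffun=> v0] (enum_uniq V).
rewrite -cardE cardsT => /(_ (leqnn _)); apply: le_trans.
rewrite le_eqVlt; apply/orP; left; apply/eqP; apply: eq_big => [c|c _].
  by apply/esym/forallP => i; rewrite inE mem_enum.
rewrite big_enum /=; apply: eq_bigr => v _; congr (phi #|pred_of_set _|).
by apply/setP => i; rewrite !inE.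
Qed.

End Words.

(** * Links of a rigid vertex set *)

Section Witnesses.
Context {n : nat}.
Notation V := 'I_n.

Definition link_edges (m : option V) (x y : V) : {set {set V}} :=
  if m is Some u then [set [set x; u]; [set u; y]] else [set [set x; y]].

Definition link_cost (m : option V) : nat := if m is Some _ then 2 else 1.

(* A sequence of [M] oriented links: the ends of the [i]-th one are the letters
   at [(i, false)] and [(i, true)], and its midpoint, if any, is the value of the
   second component at [i]. *)
Definition witness (M : nat) : Type :=
  ({ffun 'I_M * bool -> V} * {ffun 'I_M -> option V})%type.

HB.instance Definition _ M := Finite.on (witness M).

Definition fiber {M} (t : witness M) (v : V) : {set 'I_M * bool} :=
  [set j | t.1 j == v].

Definition witness_edges {M} (t : witness M) : {set {set V}} :=
  \bigcup_(i < M) link_edges (t.2 i) (t.1 (i, false)) (t.1 (i, true)).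

(* The condition on the cardinal says that the links use disjoint sets of edges,
   so that their presence has probability [p ^+ cost]. *)
Definition admissible {M} (t : witness M) : bool :=
  [&& witness_edges t \subset pairs V,
      #|witness_edges t| == \sum_(i < M) link_cost (t.2 i),
      [forall v, (#|fiber t v| == 0) || (3 <= #|fiber t v|)]
    & 9 * #|[set v | 0 < #|fiber t v|]| <= n]%N.

Lemma link_edgesC m x y : link_edges m x y = link_edges m y x.
Proof.
by case: m => [u|]; rewrite /link_edges finset.setUC // [[set x; u]]finset.setUC
  [[set u; y]]finset.setUC.
Qed.

Section Construction.
Variables (G : sgraph V) (S A B : {set V}).
Let deg v := #|nbrs G v :&: S|.
Hypothesis deg_ge2 : forall v, v \in S -> (2 <= deg v)%N.
Hypothesis deg2_indep : forall u v, u \in S -> v \in S -> adj G u v ->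
  deg u = 2 -> deg v = 2 -> False.

Hypothesis AE : forall v, (v \in A) = (v \in S) && (deg v == 2).
Hypothesis BE : forall v, (v \in B) = (v \in S) && (3 <= deg v)%N.

(** Ordering the two ends makes each link occur once. Several links may share both ends if their
    midpoints differ. *)
Definition links : {set option V * (V * V)} :=
  [set l : option V * (V * V) | [&& l.2.1 < l.2.2, l.2.1 \in B, l.2.2 \in B &
    if l.1 is Some u then [&& u \in A, adj G u l.2.1 & adj G u l.2.2]
    else adj G l.2.1 l.2.2]%N].

Let neq_adj x y : adj G x y -> x != y.
Proof. by apply: contraTneq => ->; rewrite adj_irrefl. Qed.

Let AB v : v \in S -> v \in A \/ v \in B.
Proof.
move=> vS; rewrite AE BE vS /= eq_sym.
by have := deg_ge2 _ vS; rewrite leq_eqVlt => /orP; case; auto.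
Qed.

Let A_notin_B v : v \in A -> v \in B -> False.
Proof. by rewrite AE BE => /andP[_ /eqP->]; rewrite andbF. Qed.

Let B_sub v : v \in B -> v \in S.
Proof. by rewrite BE => /andP[]. Qed.

Let A_nbr u w : u \in A -> w \in S -> adj G u w -> w \in B.
Proof.
rewrite AE => /andP[uS /eqP du] wS uw; have [|//] := AB _ wS.
by rewrite AE => /andP[_ /eqP dw]; case: (deg2_indep _ _ uS wS uw du dw).
Qed.

Let A_nbrs u : u \in A -> exists x y : V, [/\ (x < y)%N, x \in B, y \in B &
  forall w, w \in S -> adj G u w = (w == x) || (w == y)].
Proof.
move=> uA; have := uA; rewrite AE => /andP[uS /cards2P[x [y [xy E]]]].
have N w : w \in S -> adj G u w = (w == x) || (w == y).
  move=> wS; have -> : adj G u w = (w \in nbrs G u :&: S).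
    by rewrite !inE wS andbT.
  by rewrite E !inE.
have xE : x \in nbrs G u :&: S by rewrite E !inE eqxx.
have yE : y \in nbrs G u :&: S by rewrite E !inE eqxx orbT.
have xB : x \in B by move: xE => /setIP[]; rewrite inE => ? ?; apply: (A_nbr _ _ uA).
have yB : y \in B by move: yE => /setIP[]; rewrite inE => ? ?; apply: (A_nbr _ _ uA).
have [ltxy|ltyx|exy] := ltngtP x y; first by exists x, y.
  by exists y, x; split=> // w wS; rewrite N // orbC.
by rewrite (ord_inj exy) eqxx in xy.
Qed.

(** An edge contains a vertex of [A] exactly when its link has a midpoint, and that vertex is the
    midpoint. The midpoint determines the ends, which are its only two neighbours in [S]; without a
    midpoint the edge itself gives the ends. *)
Lemma link_disjoint l l' e : l \in links -> l' \in links ->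
  e \in link_edges l.1 l.2.1 l.2.2 -> e \in link_edges l'.1 l'.2.1 l'.2.2 ->
  l = l'.
Proof.
have mids m x y u x' y' : (m, (x, y)) \in links -> (Some u, (x', y')) \in links ->
    e \in link_edges m x y -> e \in link_edges (Some u) x' y' -> m = Some u.
  rewrite !inE /= => /and4P[_ xB yB mP] /and4P[_ _ _ /and3P[uA _ _]].
  have notB z : z \in B -> (u == z) = false.
    by move=> zB; apply/negP => /eqP uz; apply: (A_notin_B _ uA); rewrite uz.
  case: m mP => [u' _|_] /=; rewrite !inE => eE eE'.
    have : u \in e by case/orP: eE' => /eqP->; rewrite !inE eqxx ?orbT.
    by case/orP: eE => /eqP->; rewrite !inE ?(notB _ xB) ?(notB _ yB) ?orbF => /eqP->.
  have : u \in e by case/orP: eE' => /eqP->; rewrite !inE eqxx ?orbT.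
  by move/eqP: eE => ->; rewrite !inE (notB _ xB) (notB _ yB).
case: l l' => [m [x y]] [m' [x' y']] lL lL' eE eE'.
have mm' : m = m'.
  case: m' lL' eE' => [u' lL' eE'|lL' eE']; first exact: mids lL lL' eE eE'.
  by case: m lL eE => // u lL eE; have := mids _ _ _ _ _ _ lL' lL eE' eE.
rewrite mm' in lL eE *; congr (_, _).
move: lL lL'; rewrite !inE /= => /and4P[xy xB yB mP] /and4P[xy' xB' yB' mP'].
have pair_eq : x \in [set x'; y'] -> y \in [set x'; y'] -> (x, y) = (x', y').
  rewrite !inE => /orP[] /eqP ex /orP[] /eqP ey; rewrite ?ex ?ey //;
    by exfalso; rewrite ex ey in xy; lia.
case: m' mm' mP mP' eE eE' => [u|] _ /=; last first.
  by rewrite !inE => _ _ /eqP-> /eqP exy; apply: pair_eq; rewrite -exy !inE eqxx ?orbT.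
move=> /and3P[uA ux uy] /and3P[_ ux' uy'] _ _.
have [a [b [_ _ _ N]]] := A_nbrs _ uA.
move: ux uy ux' uy'; rewrite !N ?B_sub // => ux uy ux' uy'.
have neq : x != y by apply/eqP => exy; rewrite exy ltnn in xy.
have neq' : x' != y' by apply/eqP => exy; rewrite exy ltnn in xy'.
apply: pair_eq; rewrite !inE.
  by case/orP: ux => /eqP->; case/orP: ux' neq' => /eqP->; case/orP: uy' => /eqP->;
    rewrite ?eqxx ?orbT.
by case/orP: uy => /eqP->; case/orP: ux' neq' => /eqP->; case/orP: uy' => /eqP->;
    rewrite ?eqxx ?orbT.
Qed.

Lemma link_edges_sub l : l \in links ->
  link_edges l.1 l.2.1 l.2.2 \subset edges G.
Proof.
case: l => [[u|] [x y]]; rewrite inE /= => /and4P[_ _ _ mP]; apply/fintype.subsetP => e.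
  rewrite !inE; case/and3P: mP => _ ux uy /orP[] /eqP->; last exact: uy.
  by rewrite finset.setUC; exact: ux.
by rewrite inE => /eqP->.
Qed.

Lemma card_link_edges l : l \in links ->
  #|link_edges l.1 l.2.1 l.2.2| = link_cost l.1.
Proof.
case: l => [[u|] [x y]]; rewrite inE /= => /and4P[xy _ _ mP]; last exact: cards1.
rewrite cards2; case: eqP => //= /setP/(_ x); rewrite !inE eqxx /=.
case/and3P: mP => _ ux _; rewrite eq_sym (negPf (neq_adj _ _ ux)) /=.
by move=> /esym/eqP exy; rewrite exy ltnn in xy.
Qed.

Lemma link_at v w : v \in B -> w \in S -> adj G v w ->
  exists2 l, l \in links & exists s : bool,
    (if s then l.2.1 else l.2.2) = v /\ odflt (if s then l.2.2 else l.2.1) l.1 = w.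
Proof.
move=> vB wS vw; have wv : adj G w v by rewrite adj_sym.
have [wA|wB] := AB _ wS.
  have [x [y [xy xB yB N]]] := A_nbrs _ wA.
  exists (Some w, (x, y)).
    by rewrite inE /= xy xB yB wA !N ?B_sub // !eqxx orbT.
  move: wv; rewrite N ?B_sub // => /orP[] /eqP->.
    by exists true.
  by exists false.
have [ltvw|ltwv|evw] := ltngtP v w.
- by exists (None, (v, w)); [rewrite inE /= ltvw vB wB vw|exists true].
- by exists (None, (w, v)); [rewrite inE /= ltwv vB wB wv|exists false].
- by move: vw; rewrite (ord_inj evw) adj_irrefl.
Qed.

Let M := #|links|.
Let lam : 'I_M -> option V * (V * V) := enum_val.
Let lamP i : lam i \in links. Proof. exact: enum_valP. Qed.

(** The permutation orders the links and the booleans orient them; this yields the factor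
    [2 ^ M * M!]. *)
Definition links_witness (s : 'S_M * {ffun 'I_M -> bool}) : witness M :=
  ([ffun j => if s.2 j.1 (+) j.2 then (lam (s.1 j.1)).2.1 else (lam (s.1 j.1)).2.2],
   [ffun i => (lam (s.1 i)).1]).

Lemma links_witness_inj : injective links_witness.
Proof.
move=> [p o] [p' o'] [/ffunP ec /ffunP em].
have step i : o i = o' i /\ lam (p i) = lam (p' i).
  have := em i; rewrite !ffunE /=.
  have := ec (i, false); have := ec (i, true); rewrite !ffunE /= !addbF !addbT.
  have := lamP (p i); have := lamP (p' i).
  case: (lam (p i)) => [m [x y]]; case: (lam (p' i)) => [m' [x' y']].
  rewrite !inE /= => /and4P[xy' _ _ _] /and4P[xy _ _ _].
  case: (o i); case: (o' i) => /= e1 e2 ->; rewrite ?e1 ?e2 //;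
    by exfalso; move: xy; rewrite e1 e2; lia.
congr (_, _); last by apply/ffunP => i; case: (step i).
by apply/permP => i; case: (step i) => _ /enum_val_inj.
Qed.

Lemma links_witness_edges s i :
  let t := links_witness s in
  link_edges (t.2 i) (t.1 (i, false)) (t.1 (i, true)) =
  link_edges (lam (s.1 i)).1 (lam (s.1 i)).2.1 (lam (s.1 i)).2.2.
Proof. by rewrite /= !ffunE /= addbF addbT; case: (s.2 i) => //=; rewrite link_edgesC. Qed.

Lemma links_witness_sub s : witness_edges (links_witness s) \subset edges G.
Proof.
by apply/bigcupsP => i _; rewrite links_witness_edges; apply: link_edges_sub.
Qed.

Lemma links_witness_fiber0 s v : v \notin B -> #|fiber (links_witness s) v| = 0.
Proof.
move=> vB; apply: eq_card0 => j; rewrite !inE ffunE; apply/negbTE.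
apply: contra vB => /eqP <-.
by have := lamP (s.1 j.1); rewrite inE => /and4P[_ xB yB _]; case: ifP.
Qed.

(** Every neighbour of [v] in [S] is reached along some link at [v], so the occurrences of [v] map
    onto these neighbours. *)
Lemma links_witness_fiber3 s v : v \in B -> (3 <= #|fiber (links_witness s) v|)%N.
Proof.
move=> vB; have : (3 <= deg v)%N by move: vB; rewrite BE => /andP[].
move/leq_trans; apply.
pose t := links_witness s.
(* This is the vertex next to the letter at [j] along its link: the midpoint if there is one, the
   opposite end otherwise. *)
pose other (j : 'I_M * bool) := odflt (t.1 (j.1, ~~ j.2)) (t.2 j.1).
apply: leq_trans (leq_imset_card other (mem (fiber t v))); apply: subset_leq_card.
apply/fintype.subsetP => w; rewrite !inE => /andP[vw wS].
have [l lL [b [ev ew]]] := link_at _ _ vB wS vw.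
pose i := (s.1^-1)%g (enum_rank_in lL l).
have li : lam (s.1 i) = l by rewrite /i permKV /lam enum_rankK_in.
apply/imsetP; exists (i, s.2 i (+) b); rewrite ?inE /other /t /= !ffunE /= li.
  by rewrite addbA addbb ev.
rewrite addbN addbA addbb /=; case: (b) ew => /= <- //.
Qed.

Lemma links_witness_cost s : #|witness_edges (links_witness s)| =
  (\sum_(i < M) link_cost ((links_witness s).2 i))%N.
Proof.
rewrite -sum1_card /witness_edges partition_disjoint_bigcup => [|i j ij].
  apply: eq_bigr => i _; rewrite sum1_card links_witness_edges card_link_edges //.
  by rewrite ffunE.
rewrite !links_witness_edges -setI_eq0; apply/eqP/setP => e; rewrite !inE.
apply/negP => /andP[ei ej]; case/negP: ij; apply/eqP.
apply: (@perm_inj _ s.1); apply: enum_val_inj.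
exact: link_disjoint (lamP _) (lamP _) ei ej.
Qed.

Lemma links_witness_admissible s : (9 * #|B| <= n)%N ->
  admissible (links_witness s).
Proof.
move=> Bn; rewrite /admissible (fintype.subset_trans (links_witness_sub s) (edges_pairs G)).
rewrite links_witness_cost eqxx /=; apply/andP; split.
  apply/forallP => v; have [vB|vB] := boolP (v \in B).
    by rewrite links_witness_fiber3 ?orbT.
  by rewrite links_witness_fiber0.
apply: leq_trans Bn; rewrite leq_mul2l /= subset_leq_card //.
apply/fintype.subsetP => v; rewrite inE; apply: contraTT => vB.
by rewrite links_witness_fiber0.
Qed.

(** Each vertex of [A] is the midpoint of a link, so [#|A| <= M]. A word of length [2M] contains
    each letter of [B] three times, so [3 * #|B| <= 2 * M]. *)
Lemma card_links_ge : (3 * #|S| <= 5 * #|links|)%N.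
Proof.
have cardS : (#|S| = #|A| + #|B|)%N.
  rewrite -cardsUI (_ : A :&: B = finset.set0) ?cards0 ?addn0.
    apply: eq_card => v; rewrite inE AE BE -andb_orr; case vS: (v \in S) => //=.
    by have := deg_ge2 _ vS; rewrite leq_eqVlt eq_sym.
  apply/setP => v; rewrite [RHS]inE; apply/negP; rewrite finset.in_setI.
  by move=> /andP[]; apply: A_notin_B.
have leA : (#|A| <= M)%N.
  rewrite -(card_imset _ (@Some_inj _)).
  apply: leq_trans (leq_imset_card (fun l => l.1) (mem links)).
  apply: subset_leq_card; apply/fintype.subsetP => _ /imsetP[u uA ->].
  have [x [y [xy xB yB N]]] := A_nbrs _ uA.
  apply/imsetP; exists (Some u, (x, y)) => //.
  by rewrite inE /= xy xB yB uA !N ?B_sub // !eqxx orbT.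
have leB : (3 * #|B| <= 2 * M)%N.
  pose t := links_witness (1%g, [ffun=> true]).
  have -> : (2 * M)%N = (\sum_v #|fiber t v|)%N.
    rewrite mulnC -{1}[M]card_ord -card_bool -card_prod -sum1_card.
    rewrite (partition_big t.1 predT) //=; apply: eq_bigr => v _.
    by rewrite sum1dep_card.
  rewrite (bigID [in B]) /=; apply: leq_trans (leq_addr _ _).
  rewrite mulnC -sum_nat_const; apply: leq_sum => v vB.
  exact: links_witness_fiber3.
rewrite -/M cardS; lia.
Qed.

End Construction.

(** The lower bound on [M] makes each term of the later union bound small; the crude upper bound,
    the number of all triples, keeps the number of terms polynomial. *)
Lemma rigid_witnesses {R : realType} (G : sgraph V) (S : {set V}) :
  (4 <= #|S|)%N -> globally_rigid R (induced_subgraph G S) ->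
  (9 * #|[set v | 3 <= #|nbrs G v|]| <= n)%N ->
  exists M, [/\ (3 * #|S| <= 5 * M)%N, (M <= n.+1 * (n * n))%N &
    (2 ^ M * M`! <=
      #|[set t : witness M | admissible t & (witness_edges t \subset edges G)]|)%N].
Proof.
move=> S4 rig deg3.
pose H := induced_subgraph G S.
have cardH : #|{: {x | x \in S}}| = #|S| by rewrite card_sig.
have degH x : #|nbrs H x| = #|nbrs G (val x) :&: S|.
  rewrite -(card_imset _ val_inj); apply: eq_card => w; rewrite !inE.
  apply/imsetP/andP => [[y yN ->]|[xw wS]].
    by move: yN; rewrite inE adj_induced => ->; split=> //; apply: valP.
  by exists (Sub w wS) => //; rewrite inE adj_induced.
have deg_ge2 v : v \in S -> (2 <= #|nbrs G v :&: S|)%N.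
  move=> vS; rewrite -[v]/(val (Sub v vS : {x | x \in S})) -degH.
  by apply: rigid_min_degree rig; rewrite cardH; lia.
have deg2_indep u v : u \in S -> v \in S -> adj G u v ->
    #|nbrs G u :&: S| = 2 -> #|nbrs G v :&: S| = 2 -> False.
  move=> uS vS uv.
  rewrite -[u]/(val (Sub u uS : {x | x \in S})) -[v]/(val (Sub v vS : {x | x \in S})).
  rewrite -!degH; apply: (rigid_degree2_indep _ _ _ _ rig); first by rewrite cardH.
  by rewrite adj_induced.
pose A := [set v in S | #|nbrs G v :&: S| == 2].
pose B := [set v in S | 3 <= #|nbrs G v :&: S|]%N.
have AE v : (v \in A) = (v \in S) && (#|nbrs G v :&: S| == 2) by rewrite inE.
have BE v : (v \in B) = (v \in S) && (3 <= #|nbrs G v :&: S|)%N by rewrite inE.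
have B_small : (9 * #|B| <= n)%N.
  apply: leq_trans deg3; rewrite leq_mul2l /= subset_leq_card //.
  apply/fintype.subsetP => v; rewrite !inE => /andP[_ /leq_trans]; apply.
  by rewrite subset_leq_card // subsetIl.
exists #|links G A B|; split.
- exact: (card_links_ge G S A B deg_ge2 deg2_indep AE BE).
- apply: leq_trans (max_card _) _.
  by rewrite !card_prod card_option card_ord.
have <- : #|{: 'S_#|links G A B| * {ffun 'I_#|links G A B| -> bool}}| =
    (2 ^ #|links G A B| * (#|links G A B|)`!)%N.
  by rewrite card_prod card_ffun card_bool card_ord card_Sn mulnC.
rewrite -(card_imset _ (links_witness_inj G A B)).
apply: subset_leq_card; apply/fintype.subsetP => _ /imsetP[s _ ->].
rewrite inE links_witness_sub andbT.
exact: (links_witness_admissible G S A B deg_ge2 deg2_indep AE BE).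
Qed.

End Witnesses.

(** * The expected number of link words *)

Section FirstMoment.
Context {R : realType}.
Implicit Types (x y p theta : R).

Let tail3 y : R := expR y - 1 - y - y ^+ 2 / 2.

(* [theta] prices each letter in use, to exploit that at most [n / 9] letters are
   used; it is only needed when the word is long enough, i.e., for large [y]. *)
Lemma tail3_tilt y : 0 < y ->
  exists2 theta : R, 0 <= theta & theta / 9 + expR (- theta) * tail3 y <= y ^+ 2 / 5.
Proof.
move=> y0; have le_tail := expR_tail3_le y (ltW y0); rewrite -/(tail3 y) in le_tail.
have [y_small|y_large] := lerP y (4 / 5).
  exists 0; rewrite // oppr0 expR0 mul0r add0r mul1r; apply: le_trans le_tail _.
  have exp_small : expR (y ^+ 2 / 20) <= 25 / 24.
    have : y ^+ 2 / 20 <= 4 / 125 by nra.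
    move: (y ^+ 2 / 20) => z zle; have := expR_gt0 z; have := expR_ge1Dx (- z).
    rewrite expRN => h E0.
    have : (1 - z) * expR z <= 1 by rewrite -ler_pdivlMr // div1r.
    by move: zle E0; move: (expR z) => E; clear; nra.
  have h : y ^+ 3 / 6 + y ^+ 4 / 24 <= y ^+ 2 * (4 / 25).
    have -> : y ^+ 3 / 6 + y ^+ 4 / 24 = y ^+ 2 * (y / 6 + y ^+ 2 / 24) by ring.
    by rewrite ler_wpM2l ?exprn_ge0 ?(ltW y0) //; nra.
  apply: le_trans (ler_pM _ (expR_ge0 _) h exp_small) _; last by nra.
  by rewrite addr_ge0 ?divr_ge0 ?exprn_ge0 ?ltW.
(* With this choice [theta / 9] falls short of [y ^+ 2 / 5] by exactly 1/9, which is what remains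
   for the second term. *)
pose theta := 9 / 5 * y ^+ 2 - 1; have theta0 : 0 <= theta by rewrite /theta; nra.
exists theta => //.
suff h : 9 * tail3 y <= expR theta.
  have : expR (- theta) * tail3 y <= 1 / 9.
    by rewrite expRN ler_pdivrMl ?expR_gt0 //; lra.
  have -> : theta / 9 = y ^+ 2 / 5 - 1 / 9 by rewrite /theta; lra.
  by move: (_ * tail3 y) (y ^+ 2 / 5) => a b; clear; lra.
(* Removing [y ^+ 2 / 20] from [theta] cancels the exponential in the bound on [tail3 y]. A
   polynomial inequality remains once [expR x] is replaced by its first three terms. *)
pose x := 7 / 4 * y ^+ 2 - 1; have x0 : 0 <= x by rewrite /x; nra.
have -> : theta = x + y ^+ 2 / 20 by rewrite /theta /x; lra.
rewrite expRD; apply: le_trans (_ : 9 * (y ^+ 3 / 6 + y ^+ 4 / 24) * expR (y ^+ 2 / 20) <= _).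
  by move: le_tail; lra.
rewrite ler_wpM2r ?expR_ge0 //; apply: le_trans (exp_partial_sum_le x 3 x0).
rewrite !big_ord_recr big_ord0 /= !factS fact0 /= /x.
rewrite expr0 expr1 add0r !divr1.
have -> : (2 * (1 * 1))%:R = 2 :> R by [].
have sq1 := sqr_ge0 (43 / 40 * y ^+ 2 - 7 / 10 * y - 9 / 20).
have sq2 := sqr_ge0 (y - 13 / 20).
by move: sq1 sq2 (sqr_ge0 (y ^+ 2)) y0; clear; nra.
Qed.

Section Count.
Context {n M : nat}.
Hypotheses (n_gt0 : (0 < n)%N) (M_gt0 : (0 < M)%N).

Let fib (c : {ffun 'I_M * bool -> 'I_n}) v := [set j | c j == v].

Let good c := [forall v, (#|fib c v| == 0) || (3 <= #|fib c v|)]%N &&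
  (9 * #|[set v | 0 < #|fib c v|]| <= n)%N.

(** Give multiplicity 0 weight 1, multiplicities 1 and 2 weight 0, and the others weight
    [expR (- theta)]. Since a good word uses at most [n / 9] letters, its weight times
    [expR (n * theta / 9)] is at least 1. The generating function is then at most
    [1 + expR (- theta) * tail3 y]. *)
Lemma card_good_words y theta : 0 < y -> 0 <= theta ->
  #|[pred c | good c]|%:R <=
    M.*2`!%:R / y ^+ M.*2 *
    expR (n%:R * (theta / 9 + expR (- theta) * tail3 y)).
Proof.
move=> y0 theta0.
pose phi d : R := if d == 0%N then 1 else if (3 <= d)%N then expR (- theta) else 0.
have phi_ge0 d : 0 <= phi d by rewrite /phi; do 2?case: ifP => _ //; apply: expR_ge0.
have good_le c : good c -> 1 <= expR (n%:R * (theta / 9)) * \prod_v phi #|fib c v|.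
  move=> /andP[/forallP fib03 im9].
  have -> : \prod_v phi #|fib c v| = expR (- theta) ^+ #|[set v | 0 < #|fib c v|]%N|.
    rewrite -prodr_const [RHS]big_mkcond; apply: eq_bigr => v _; rewrite inE /phi.
    by case: #|fib c v| (fib03 v) => [|[|[|k]]].
  rewrite -expRM_natl -expRD -[leLHS]expR0 ler_expR.
  have : 9 * #|[set v | 0 < #|fib c v|]%N|%:R <= n%:R :> R by rewrite -natrM ler_nat.
  by move: theta0; move: (#|_|%:R) (n%:R : R) => a b; nra.
pose egf := \sum_(d < M.*2.+1) phi d * y ^+ d / d`!%:R.
have words : \sum_(c : {ffun 'I_M * bool -> 'I_n}) \prod_v phi #|fib c v| <=
    M.*2`!%:R / y ^+ M.*2 * egf ^+ n.
  have := @sum_words R ('I_M * bool)%type 'I_n phi y phi_ge0 y0.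
  by rewrite card_prod card_bool !card_ord muln2.
have egf_le : egf <= expR (expR (- theta) * tail3 y).
  apply: le_trans (expR_ge1Dx _).
  have [k kE] : exists k, (M.*2.+1 = k.+3)%N by exists M.*2.-2; lia.
  rewrite /egf kE !big_ord_recl /= !/bump /= /phi /= !mul0r !add0r.
  rewrite expr0 fact0 divr1 mulr1 lerD2l.
  under eq_bigr do rewrite -mulrA.
  rewrite -mulr_sumr ler_wpM2l ?expR_ge0 //.
  have := exp_partial_sum_le y k.+3 (ltW y0).
  rewrite !big_ord_recl /= !/bump /= /tail3.
  rewrite !addn0 !factS fact0 expr0 expr1 !muln1 !divr1.
  set t := \sum_(_ < k) _; move: t (expR y) => t E; lra.
have egf_ge0 : 0 <= egf.
  by apply: sumr_ge0 => d _; rewrite divr_ge0 ?mulr_ge0 ?exprn_ge0 ?(ltW y0).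
rewrite -sumr_const.
apply: le_trans (_ : expR (n%:R * (theta / 9)) *
    \sum_(c : {ffun 'I_M * bool -> 'I_n}) \prod_v phi #|fib c v| <= _).
  rewrite mulr_sumr big_mkcond; apply: ler_sum => c _; case: ifP => [/good_le//|_].
  by rewrite mulr_ge0 ?expR_ge0 ?prodr_ge0.
apply: le_trans (ler_wpM2l (expR_ge0 _) words) _.
rewrite mulrCA ler_wpM2l ?divr_ge0 ?exprn_ge0 ?(ltW y0) //.
rewrite mulrDr expRD ler_wpM2l ?expR_ge0 // expRM_natl.
by rewrite lerXn2r ?nnegrE ?expR_ge0.
Qed.

(** Dropping the conditions on edges makes midpoints independent of the word. Each link then
    contributes [p] without midpoint and [p ^+ 2] for each of the [n] midpoints. *)
Lemma sum_link_costs p : 0 <= p ->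
  \sum_(t : witness (n := n) M | admissible t)
     p ^+ (\sum_(i < M) link_cost (t.2 i)) <=
  #|[pred c | good c]|%:R * (p + n%:R * p ^+ 2) ^+ M.
Proof.
move=> p0.
apply: le_trans (_ : \sum_(c | good c) \sum_(m : {ffun 'I_M -> option 'I_n})
   p ^+ (\sum_(i < M) link_cost (m i)) <= _).
  rewrite pair_big /= big_mkcond [leRHS]big_mkcond; apply: ler_sum => -[c m] _ /=.
  rewrite /admissible /good andbT.
  case: ifP => [/and4P[_ _ h1 h2]|_]; first by rewrite h1 h2.
  by case: ifP => // _; rewrite exprn_ge0.
rewrite le_eqVlt; apply/orP; left; apply/eqP.
have -> : (p + n%:R * p ^+ 2) ^+ M =
    \sum_(m : {ffun 'I_M -> option 'I_n}) p ^+ (\sum_(i < M) link_cost (m i)).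
  under [RHS]eq_bigr do rewrite expr_sum.
  rewrite -(bigA_distr_bigA (fun _ (m : option 'I_n) => p ^+ link_cost m)).
  rewrite prodr_const card_ord; congr (_ ^+ _).
  rewrite (bigD1 None) //= expr1; congr (_ + _).
  rewrite (eq_bigr (fun=> p ^+ 2)) => [|[u|] //].
  by rewrite sumr_const cardC1 card_option card_ord mulr_natl.
by rewrite mulr_natl -sumr_const.
Qed.

(** Here 231/100 is [11/10 + (11/10)^2], the bound on [n] times the weight of a link. Stirling gives
    the exponent [- M] and the words give [n * y ^+ 2 / 5 = 231/250 * M]; the sum is
    [- 19/250 * M]. *)
Lemma many_witnesses_pr p : 0 <= p <= 1 -> p <= 11 / 10 / n%:R ->
  gnp_pr p (fun G : sgraph 'I_n => (2 ^ M * M`! <=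
     #|[set t : witness M | admissible t & (witness_edges t \subset edges G)]|)%N)
  <= expR 1 * M%:R * expR (- (19 / 250 * M%:R)).
Proof.
move=> p01 p_le; have /andP[p0 _] := p01.
have n0 : 0 < n%:R :> R by rewrite ltr0n.
have M0 : 0 < M%:R :> R by rewrite ltr0n.
set pr := gnp_pr _ _.
have markov : (2 ^ M * M`!)%:R * pr <=
    #|[pred c | good c]|%:R * (p + n%:R * p ^+ 2) ^+ M.
  apply: le_trans (sum_link_costs p p0).
  apply: le_trans (gnp_pr_markov _ (@admissible n M)
    (fun t G => witness_edges t \subset edges G) _ _ _ p01 _) _.
    by move=> G /= h; apply: (leq_trans h); apply: subset_leq_card; apply/fintype.subsetP => t;
      rewrite !inE => /andP[-> tG]; apply/asboolP.
  rewrite le_eqVlt; apply/orP; left; apply/eqP; apply: eq_bigr => t.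
  by rewrite /admissible => /and4P[tP /eqP <- _ _]; apply: gnp_pr_superset.
have mu_le : p + n%:R * p ^+ 2 <= 231 / 100 / n%:R.
  have pn : p * n%:R <= 11 / 10 by rewrite -ler_pdivlMr.
  rewrite ler_pdivlMr //.
  have -> : (p + n%:R * p ^+ 2) * n%:R = p * n%:R + (p * n%:R) ^+ 2 by ring.
  have : 0 <= p * n%:R by rewrite mulr_ge0 // ler0n.
  by move: pn; move: (p * n%:R) => z; nra.
(* The choice of [y] which optimizes the bound of [card_good_words]. *)
pose y := Num.sqrt (231 / 50 * M%:R / n%:R : R).
have y2 : y ^+ 2 = 231 / 50 * M%:R / n%:R.
  by rewrite sqr_sqrtr // !mulr_ge0 ?invr_ge0 ?ler0n.
have y0 : 0 < y by rewrite sqrtr_gt0 !mulr_gt0 ?invr_gt0 ?ltr0n.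
have [theta theta0 tilt] := tail3_tilt y y0.
have words := card_good_words y theta y0 theta0.
have exp_le : expR (n%:R * (theta / 9 + expR (- theta) * tail3 y)) <=
    expR (231 / 250 * M%:R).
  rewrite ler_expR; apply: le_trans (ler_wpM2l (ltW n0) tilt) _.
  by rewrite y2 le_eqVlt; apply/orP; left; apply/eqP; field; rewrite lt0r_neq0.
(* As [y ^+ 2] is [2 * M] times [231 / 100 / n], the powers of the latter cancel and
   [(2M)! / (2M)^M] is left. *)
have stirling : M.*2`!%:R / y ^+ M.*2 * (231 / 100 / n%:R) ^+ M <=
    (2 ^ M * M`!)%:R * (expR 1 * M%:R * expR (- M%:R)) :> R.
  rewrite -mul2n exprM y2.
  have -> : (2 * M)`!%:R / (231 / 50 * M%:R / n%:R) ^+ M * (231 / 100 / n%:R) ^+ M =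
      (2 * M)`!%:R / (2 * M%:R) ^+ M :> R.
    rewrite -!mulrA; congr (_ * _); rewrite -!exprVn -exprMn; congr (_ ^+ _).
    by field; rewrite !lt0r_neq0.
  rewrite ler_pdivrMr ?exprn_gt0 ?mulr_gt0 //.
  apply: le_trans (_ : (4 ^ M * M`! ^ 2)%:R <= _).
    by rewrite ler_nat mul2n fact_double_le.
  rewrite -mulnn mulnA natrM.
  apply: le_trans (ler_wpM2l (ler0n _ _) (fact_le_stirling M M_gt0)) _.
  rewrite exprMn !natrM !natrX (_ : 4 = 2 * 2 :> R) ?exprMn; last by ring.
  by rewrite le_eqVlt; apply/orP; left; apply/eqP; ring.
have c0 : 0 < (2 ^ M * M`!)%:R :> R by rewrite ltr0n muln_gt0 expn_gt0 fact_gt0.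
rewrite -(ler_pM2l c0); apply: le_trans markov _.
apply: le_trans (_ : M.*2`!%:R / y ^+ M.*2 * expR (231 / 250 * M%:R) *
    (231 / 100 / n%:R) ^+ M <= _).
  rewrite ler_pM ?exprn_ge0 ?addr_ge0 ?mulr_ge0 ?exprn_ge0 ?(ltW n0) //.
    apply: le_trans words _; rewrite ler_wpM2l // divr_ge0 ?exprn_ge0 //; exact: ltW.
  by rewrite lerXn2r ?nnegrE ?addr_ge0 ?mulr_ge0 ?invr_ge0 ?exprn_ge0 ?(ltW n0).
rewrite mulrAC; apply: le_trans (ler_wpM2r (expR_ge0 _) stirling) _.
rewrite le_eqVlt; apply/orP; left; apply/eqP.
by rewrite -!mulrA -expRD; congr (_ * (_ * (_ * expR _))); lra.
Qed.

End Count.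

End FirstMoment.

(** * Vertices of degree at least 3 *)

(** In other words, a Poisson variable of mean at most 1.1 is at least 3 with probability at most
    0.105. *)
Lemma tail3_le_exp {R : realType} (x : R) : 0 <= x <= 11 / 10 ->
  expR x - 1 - x - x ^+ 2 / 2 <= 105 / 1000 * expR x.
Proof.
move=> /andP[x0 x1]; apply: le_trans (expR_tail3_le x x0) _.
have := exp_partial_sum_le x 4 x0.
rewrite !big_ord_recr big_ord0 /= !factS fact0 !muln1 expr0 expr1 add0r !divr1.
set E := expR x => E_ge.
have exp_small : expR (x ^+ 2 / 20) <= 1065 / 1000.
  have : x ^+ 2 / 20 <= 121 / 2000 by nra.
  move: (x ^+ 2 / 20) => z zle; have := expR_gt0 z; have := expR_ge1Dx (- z).
  rewrite expRN => h E0.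
  have : (1 - z) * expR z <= 1 by rewrite -ler_pdivlMr // div1r.
  by move: zle E0; move: (expR z) => F; clear; nra.
have x2 : 0 <= x ^+ 3 / 6 + x ^+ 4 / 24 by rewrite addr_ge0 ?divr_ge0 ?exprn_ge0.
apply: le_trans (ler_wpM2l x2 exp_small) _.
apply: le_trans (ler_wpM2l (_ : 0 <= 105 / 1000) E_ge); last by lra.
have x3 : x ^+ 3 <= 121 / 100 * x by nra.
by nra.
Qed.

Section HighDegrees.
Context {R : realType} {n : nat}.
Notation V := 'I_n.
Implicit Types (p : R) (J : {set V}).

Definition star_edges J (N : V -> {set V}) : {set {set V}} :=
  [set [set t.1; t.2] | t in [set t : V * V | (t.1 \in J) && (t.2 \in N t.1)]]%SET.

Lemma star_edges_sub_pairs J (N : V -> {set V}) : (forall v, v \in J -> N v \subset ~: J) ->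
  star_edges J N \subset pairs V.
Proof.
move=> NJ; apply/fintype.subsetP => _ /imsetP[[v u] /= + ->].
rewrite !inE /= => /andP[vJ uN]; rewrite cards2.
have := fintype.subsetP (NJ v vJ) u uN; rewrite inE.
by case: (eqVneq v u) => // <-; rewrite vJ.
Qed.

(** An edge leaving [J] has a single end in [J], so it determines the pair [(v, u)] and nothing is
    counted twice. *)
Lemma card_star_edges J (N : V -> {set V}) : (forall v, v \in J -> N v \subset ~: J) ->
  #|star_edges J N| = (\sum_(v in J) #|N v|)%N.
Proof.
move=> NJ; rewrite card_in_imset => [|[v u] [v' u']].
  under [RHS]eq_bigr do rewrite -sum1_card.
  rewrite (pair_big_dep (mem J) (fun v u => u \in N v)) /= sum1dep_card.
  by apply: eq_card => t; rewrite !inE.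
rewrite !inE /= => /andP[vJ uN] /andP[vJ' uN'] /setP e.
have outside w : w \in ~: J -> (v == w) = false /\ (v' == w) = false.
  rewrite inE => wJ; split; apply/negbTE; apply: contraNneq wJ => <- //.
have [vu v'u] := outside _ (fintype.subsetP (NJ v vJ) u uN).
have [vu' v'u'] := outside _ (fintype.subsetP (NJ v' vJ') u' uN').
have := e v; have := e u; rewrite !inE !eqxx orbT /= vu' orbF.
by rewrite (eq_sym u) v'u /= => /esym/eqP-> /esym/eqP->.
Qed.

(** The first three binomial terms are bounded below by the Poisson ones of mean [x = m * p]. The
    loss is at most 1/1000 because [p] is tiny, and the Poisson tail is at most 0.105. *)
Lemma binomial_tail_le (m : nat) p : (2 <= m)%N -> 0 <= p <= 1 / 100 / 100 ->
  m%:R * p <= 11 / 10 ->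
  \sum_(d < m.+1) 'C(m, d)%:R * (if (3 <= d)%N then p ^+ d * (1 - p) ^+ (m - d) else 0)
   <= 106 / 1000.
Proof.
move=> m2 /andP[p0 p_small] mp; set tail := \sum_(d < _) _.
pose x := m%:R * p; have x0 : 0 <= x by rewrite mulr_ge0.
pose head := (1 - p) ^+ m + m%:R * p * (1 - p) ^+ m.-1
  + 'C(m, 2)%:R * p ^+ 2 * (1 - p) ^+ m.-2.
have total : head + tail = 1.
  transitivity ((1 - p + p) ^+ m); last by rewrite subrK expr1n.
  transitivity (\sum_(d < m.+1) 'C(m, d)%:R * (p ^+ d * (1 - p) ^+ (m - d))).
    case: m m2 @tail @head {mp x x0} => [|[|k]] // _ /=.
    rewrite !big_ord_recl /= !/bump /= !mulr0 !add0r !addn0.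
    by rewrite bin0 bin1 expr0 !mul1r subn0 subn1 subn2 /= expr1 -!addrA !mulrA.
  by rewrite exprDn; apply: eq_bigr => d _; rewrite -[RHS]mulr_natl [p ^+ _ * _]mulrC.
have q0 : 0 <= 1 - p by lra.
have q1 : 1 - p <= 1 by lra.
have bin2 : 'C(m, 2)%:R * p ^+ 2 = (x ^+ 2 - x * p) / 2.
  have : 'C(m, 2)%:R * 2 = m%:R * (m%:R - 1) :> R.
    transitivity (('C(m, 2) * 2`!)%:R : R); first by rewrite natrM.
    rewrite bin_ffact !ffactnS ffactn0 muln1 natrM.
    by rewrite -subn1 natrB // ltnW.
  rewrite /x; move: ('C(m, 2)%:R : R) => c hc.
  by apply: (mulIf (_ : 2 != 0 :> R)); rewrite // mulrAC hc; field.
have pow_ge k : (1 - p) ^+ m <= (1 - p) ^+ (m - k).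
  by apply: ler_wiXn2l => //; apply: leq_subr.
have head_ge : (1 - p) ^+ m * (1 + x + (x ^+ 2 - x * p) / 2) <= head.
  rewrite /head bin2 -/x !mulrDr mulr1 -!(mulrC _ ((1 - p) ^+ m)).
  have b0 : 0 <= (x ^+ 2 - x * p) / 2 by rewrite -bin2 mulr_ge0 ?exprn_ge0.
  rewrite lerD // ?lerD //.
    by rewrite ler_wpM2l // -subn1.
  by rewrite ler_wpM2l // -subn2.
(* This comes from [(1 - p) * (1 + p + 2 * p ^+ 2) >= 1] for small [p]. *)
have one_minus_ge : expR (- (p + 2 * p ^+ 2)) <= 1 - p.
  have := expR_ge1Dx (p + 2 * p ^+ 2); rewrite expRN => h.
  rewrite -[leLHS]mul1r ler_pdivrMr ?expR_gt0 //.
  by apply: le_trans (ler_wpM2l q0 h); nra.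
have pow_exp : expR (- x) * (1 - 2 * x * p) <= (1 - p) ^+ m.
  apply: le_trans (_ : expR (- (p + 2 * p ^+ 2)) ^+ m <= _); last first.
    by rewrite lerXn2r ?nnegrE ?expR_ge0.
  rewrite -expRM_natl (_ : m%:R * _ = - x + - (2 * x * p)); last by rewrite /x; ring.
  by rewrite expRD ler_wpM2l ?expR_ge0 // -mulNr -mulrN; apply: expR_ge1Dx.
have := tail3_le_exp x; rewrite x0 => /(_ mp) tail3_le.
have F1 : expR (- x) <= 1 by rewrite -expR0 ler_expR; lra.
have F0 := expR_ge0 (- x).
have FE : expR (- x) * expR x = 1 by rewrite -expRD addrC subrr expR0.
have FA : 895 / 1000 <= expR (- x) * (1 + x + x ^+ 2 / 2).
  by move: (ler_wpM2l F0 tail3_le); rewrite !mulrDr !mulrN mulrCA FE; lra.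
have xp : x * p <= 11 / 100 / 1000 by move: x0 mp; rewrite -/x; nra.
have xp0 : 0 <= x * p by rewrite mulr_ge0.
have B_ge : 1 + x + x ^+ 2 / 2 - 1 / 1000 <=
   (1 - 2 * x * p) * (1 + x + (x ^+ 2 - x * p) / 2).
  have : (x * p) * (1 + x + x ^+ 2 / 2) <= 11 / 100 / 1000 * 3.
    by rewrite ler_pM //; move: x0 mp; rewrite -/x; nra.
  by nra.
suff : 894 / 1000 <= head by lra.
apply: le_trans head_ge.
have B0 : 0 <= 1 + x + (x ^+ 2 - x * p) / 2 by nra.
apply: le_trans (ler_wpM2r B0 pow_exp); rewrite -[leRHS]mulrA.
apply: le_trans (ler_wpM2l F0 B_ge); rewrite mulrBr.
by move: FA F1; move: (expR (- x)) (_ * (1 + _ + _)) => F FA'; lra.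
Qed.

Lemma star_edgesS J (N N' : V -> {set V}) :
  (forall v, v \in J -> N v \subset N' v) -> star_edges J N \subset star_edges J N'.
Proof.
move=> NN'; apply: imsetS; apply/fintype.subsetP => t; rewrite !inE.
by move=> /andP[tJ tN]; rewrite tJ (fintype.subsetP (NN' _ tJ)).
Qed.

Lemma inner_edge_pr J p : 0 <= p <= 1 ->
  gnp_pr p (fun G : sgraph V => exists x y, [/\ x \in J, y \in J & adj G x y])
  <= (#|J| ^ 2)%:R * p.
Proof.
move=> p01; have /andP[p0 _] := p01.
pose D (t : V * V) := [&& t.1 \in J, t.2 \in J & t.1 != t.2].
apply: le_trans (gnp_pr_union _ D
  (fun t G => [set [set t.1; t.2]]%SET \subset edges G) _ _ p01 _) _.
  move=> G [x [y [xJ yJ xy]]]; exists (x, y); last by rewrite finset.sub1set.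
  by rewrite /D /= xJ yJ; apply: contraTneq xy => ->; rewrite adj_irrefl.
rewrite (eq_bigr (fun=> p)) => [|t /and3P[_ _ t12]]; last first.
  rewrite gnp_pr_superset ?cards1 ?expr1 // finset.sub1set inE cards2.
  by rewrite t12.
rewrite sumr_const -[leLHS]mulr_natl ler_wpM2r // ler_nat.
rewrite -mulnn -cardsX; apply: subset_leq_card; apply/fintype.subsetP => t.
by rewrite !inE => /and3P[-> ->].
Qed.

(** Fix the neighbourhood [N v] outside [J] of every [v] in [J]. The probability of such a pattern
    is a product over [J], and summing over all choices of [N] gives a product of binomial tails.
    Outside [J] the function [N] takes the default value [finset.set0]. *)
Lemma outer_degree_pr J p : (#|J|.+2 <= n)%N -> 0 <= p <= 1 / 100 / 100 ->
  n%:R * p <= 11 / 10 ->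
  gnp_pr p (fun G : sgraph V => forall v, v \in J -> (3 <= #|nbrs G v :\: J|)%N)
  <= (106 / 1000) ^+ #|J|.
Proof.
move=> Jn p_small np; have p01 : 0 <= p <= 1 by lra.
have /andP[p0 p1] := p01.
have cardJC : #|~: J| = (n - #|J|)%N by rewrite cardsCs finset.setCK card_ord.
pose Q := [pred U : {set V} | (U \subset ~: J) && (3 <= #|U|)%N].
apply: le_trans (gnp_pr_union _ (mem (pffun_on finset.set0 (mem J) Q))
  (fun N G => edges G :&: star_edges J (fun=> ~: J) = star_edges J N)%SET _ _ p01 _) _.
  move=> G deg3; exists [ffun v => if v \in J then nbrs G v :\: J else finset.set0].
    apply/pffun_onP; split.
      by apply/fintype.subsetP => v; rewrite inE ffunE; case: ifP => //; rewrite eqxx.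
    move=> U /mapP[v]; rewrite mem_enum => vJ ->; rewrite ffunE vJ inE deg3 // andbT.
    by apply/fintype.subsetP => u; rewrite !inE => /andP[].
  apply/setP => e; rewrite inE; apply/andP/imsetP => [[eG /imsetP[[v u] /= + e_vu]]|].
    rewrite !inE /= => /andP[vJ uJ]; exists (v, u) => //.
    by rewrite !inE /= ffunE vJ !inE uJ /= /adj -e_vu.
  move=> [[v u]] /=; rewrite !inE /= ffunE => /andP[vJ]; rewrite vJ !inE.
  move=> /andP[uJ vu] ->; split=> //.
  by apply/imsetP; exists (v, u) => //; rewrite !inE /= vJ uJ.
pose m := (n - #|J|)%N.
have term N : N \in pffun_on finset.set0 (mem J) Q ->
    gnp_pr p (fun G => edges G :&: star_edges J (fun=> ~: J) = star_edges J N)%SET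
    = \prod_(v in J) (p ^+ #|N v| * (1 - p) ^+ (m - #|N v|)).
  move=> /pffun_onP[_ NQ].
  have NJ v : v \in J -> N v \subset ~: J.
    move=> vJ; have /NQ : N v \in [seq N x | x in mem J] by apply/mapP; exists v; rewrite ?mem_enum.
    by rewrite inE => /andP[].
  have sub : star_edges J N \subset star_edges J (fun=> ~: J) by apply: star_edgesS.
  rewrite gnp_pr_pattern ?star_edges_sub_pairs //.
  rewrite cardsD (finset.setIidPr sub) !card_star_edges //.
  rewrite -sumnB => [|v vJ]; last by apply: subset_leq_card; apply: NJ.
  rewrite !expr_sum -big_split /=; apply: eq_bigr => v vJ.
  by rewrite cardJC.
rewrite (eq_bigr _ term).
rewrite -(big_distr_big finset.set0 (mem J) Q
  (fun _ U => p ^+ #|U| * (1 - p) ^+ (m - #|U|))) /=.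
rewrite prodr_const; apply: lerXn2r.
- by rewrite nnegrE; apply: sumr_ge0 => U _; rewrite mulr_ge0 ?exprn_ge0 ?subr_ge0.
- by rewrite nnegrE; apply: divr_ge0; apply: ler0n.
apply: le_trans (binomial_tail_le m p _ p_small _); first last.
- by apply: le_trans np; rewrite ler_wpM2r // ler_nat leq_subr.
- by rewrite /m; lia.
rewrite /m -cardJC -(sum_subsets_card (~: J)
  (fun d => if (3 <= d)%N then p ^+ d * (1 - p) ^+ (#|~: J| - d) else 0)).
rewrite le_eqVlt; apply/orP; left; apply/eqP.
by rewrite [RHS](bigID (fun U : {set V} => 3 <= #|U|)%N) /= [X in _ = _ + X]big1
  ?addr0 => [|U /andP[_ /negPf->] //]; apply: eq_bigr => U /andP[_ ->].
Qed.

(** If no edge lies inside [J], all neighbours are outside [J], where degrees of distinct vertices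
    are independent. *)
Lemma high_degree_pr J p : (#|J|.+2 <= n)%N -> 0 <= p <= 1 / 100 / 100 ->
  n%:R * p <= 11 / 10 ->
  gnp_pr p (fun G : sgraph V => forall v, v \in J -> (3 <= #|nbrs G v|)%N)
  <= (#|J| ^ 2)%:R * p + (106 / 1000) ^+ #|J|.
Proof.
move=> Jn p_small np; have p01 : 0 <= p <= 1 by lra.
pose E (b : bool) (G : sgraph V) :=
  if b then exists x y, [/\ x \in J, y \in J & adj G x y]
  else forall v, v \in J -> (3 <= #|nbrs G v :\: J|)%N.
apply: le_trans (gnp_pr_union _ xpredT E _ _ p01 _) _.
  move=> G deg3; have [inner|no_inner] := pselect (E true G); first by exists true.
  exists false => // v vJ; apply: leq_trans (deg3 v vJ) _; apply: subset_leq_card.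
  apply/fintype.subsetP => w; rewrite !inE => vw; rewrite vw andbT.
  by apply/negP => wJ; apply: no_inner; exists v, w.
by rewrite big_bool lerD ?inner_edge_pr ?outer_degree_pr.
Qed.

End HighDegrees.

Lemma ffact_le_exp (n j : nat) : (n ^_ j <= n ^ j)%N.
Proof.
elim: j n => // j IH n; rewrite ffactnS expnS leq_mul2l; apply/orP; right.
apply: leq_trans (IH _) _.
by case: j {IH} => // j; rewrite leq_exp2r // leq_pred.
Qed.

Lemma exp_le_ffact (n j : nat) : ((n - j) ^ j <= n ^_ j)%N.
Proof.
elim: j n => // j IH n; rewrite ffactnS expnS leq_mul ?leq_subr //.
by apply: leq_trans (IH _); rewrite -subn1 -subnDA add1n.
Qed.

(** Markov's inequality for the number of [j]-sets of vertices of degree at least 3. The ratio of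
    ['C(n, j)] to ['C(n %/ 9, j)] is at most [(n / (n %/ 9 - j)) ^ j], hence at most
    [(91 / 10) ^ j]. *)
Lemma many_high_degree_le {R : realType} (n j : nat) (p : R) :
  (j.+2 <= n)%N -> (10 * n <= 91 * (n %/ 9 - j))%N ->
  0 <= p <= 1 / 100 / 100 -> n%:R * p <= 11 / 10 ->
  gnp_pr p (fun G : sgraph 'I_n => (n < 9 * #|[set v | 3 <= #|nbrs G v|]|)%N)
  <= (91 / 10) ^+ j * ((j ^ 2)%:R * p + (106 / 1000) ^+ j).
Proof.
move=> jn Kn p_small np; have p01 : 0 <= p <= 1 by lra.
have /andP[p0 _] := p01.
set pr := gnp_pr _ _; set Q := _ + _.
have Q0 : 0 <= Q.
  by apply: addr_ge0; [rewrite mulr_ge0|apply/exprn_ge0/divr_ge0; apply: ler0n].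
have pr0 : 0 <= pr by apply: gnp_pr_ge0.
have markov : 'C(n %/ 9, j)%:R * pr <= 'C(n, j)%:R * Q.
  apply: le_trans (gnp_pr_markov _ (fun J : {set 'I_n} => #|J| == j)
    (fun J G => forall v, v \in J -> (3 <= #|nbrs G v|)%N) _ _ _ p01 _) _.
    move=> G; pose X := [set v | 3 <= #|nbrs G v|]%N; rewrite -/X => many.
    have K_le : (n %/ 9 <= #|X|)%N by move: many; move: #|X| => k; lia.
    apply: leq_trans (leq_bin2l j K_le) _.
    rewrite -cards_draws; apply: subset_leq_card; apply/fintype.subsetP => J.
    rewrite !inE => /andP[JX ->]; apply/asboolP => v vJ.
    by have := fintype.subsetP JX v vJ; rewrite inE.
  apply: le_trans (_ : \sum_(J : {set 'I_n} | #|J| == j) Q <= _).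
    by apply: ler_sum => J /eqP Jj; rewrite /Q -Jj; apply: high_degree_pr; rewrite ?Jj.
  by rewrite sumr_const -[leLHS]mulr_natl -cardsE card_draws card_ord.
have main : ((n %/ 9 - j) ^ j)%:R * pr <= (n ^ j)%:R * Q.
  apply: le_trans (_ : ((n %/ 9) ^_ j)%:R * pr <= _).
    by rewrite ler_wpM2r // ler_nat exp_le_ffact.
  apply: le_trans (_ : (n ^_ j)%:R * Q <= _); last first.
    by rewrite ler_wpM2r // ler_nat ffact_le_exp.
  rewrite -!bin_ffact !natrM ![_ * j`!%:R]mulrC -!mulrA ler_wpM2l //.
have n0 : 0 < n%:R :> R by rewrite ltr0n; lia.
rewrite -(ler_pM2l (exprn_gt0 j n0)); apply: le_trans (_ : (91 / 10) ^+ j *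
  (((n %/ 9 - j) ^ j)%:R * pr) <= _).
  rewrite mulrA ler_wpM2r // natrX -exprMn; apply: lerXn2r.
  - by rewrite nnegrE ltW.
  - by rewrite nnegrE; apply: mulr_ge0; [apply: divr_ge0|]; apply: ler0n.
  rewrite mulrAC ler_pdivlMr ?ltr0n //.
  by rewrite mulrC -!natrM ler_nat.
rewrite [leRHS]mulrCA -natrX; apply: ler_wpM2l main.
by apply/exprn_ge0/divr_ge0; apply: ler0n.
Qed.

Lemma many_high_degree_near {R : realType} (e : R) : 0 < e ->
  \forall n \near eventually, forall p, 0 <= p -> p <= 11 / 10 / n%:R ->
  gnp_pr p (fun G : sgraph 'I_n => (n < 9 * #|[set v | 3 <= #|nbrs G v|]|)%N) <= e.
Proof.
move=> e0.
(* The product is 0.9646, below 1. So [j] can be fixed first, and then [n] taken large to absorb the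
   term linear in [p]. *)
have [j z_small] : exists j, (91 / 10 * (106 / 1000)) ^+ j <= e / 2 :> R.
  have z1 : `|91 / 10 * (106 / 1000) : R| < 1 by rewrite ger0_norm; lra.
  have /cvgrPdist_le/(_ (e / 2)) := cvg_expr z1.
  move=> /(_ ltac:(lra))[j _ /(_ j (leqnn j))] /=; rewrite sub0r normrN => h.
  by exists j; apply: le_trans (ler_norm _) h.
near=> n => p p0 p_le.
have n0 : 0 < n%:R :> R by rewrite ltr0n; near: n; exact: nbhs_infty_gt.
have np : n%:R * p <= 11 / 10 by rewrite mulrC -ler_pdivlMr.
have p_small : p <= 1 / 100 / 100.
  apply: le_trans p_le _; rewrite ler_pdivrMr //.
  have : 11 / 10 * 100 * 100 <= n%:R :> R by near: n; exact: nbhs_infty_ger.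
  by lra.
(* Multiplying [10 * n <= 91 * (n %/ 9 - j)] by 9 and using [9 * (n %/ 9) >= n - 8] gives this
   threshold: 728 is 91 times 8, and 819 is 91 times 9. *)
have n_large : (728 + 819 * j < n)%N by near: n; exact: nbhs_infty_gt.
apply: le_trans (many_high_degree_le n j p _ _ _ np) _; [lia|lia|by rewrite p0|].
rewrite mulrDr -exprMn (_ : e = e / 2 + e / 2) ?lerD //; last by lra.
set c := (91 / 10) ^+ j; rewrite mulrA; set d := c * _.
have d0 : 0 <= d.
  by apply: mulr_ge0; [apply/exprn_ge0/divr_ge0|]; apply: ler0n.
apply: le_trans (ler_wpM2l d0 p_le) _; rewrite mulrA ler_pdivrMr //.
have : 2 * (d * (11 / 10)) / e <= n%:R by near: n; exact: nbhs_infty_ger.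
by rewrite ler_pdivrMr //; lra.
Unshelve. all: by end_near. Qed.

(** * The theorem *)

Lemma rigid_subset_near {R : realType} (e : R) : 0 < e ->
  \forall n \near eventually, forall p : R, 0 <= p <= 1 -> p <= 11 / 10 / n%:R ->
  gnp_pr p (fun G : sgraph 'I_n => exists2 S : {set 'I_n}, 150 * ln (n%:R : R) <= #|S|%:R &
    globally_rigid R (induced_subgraph G S)) <= e.
Proof.
move=> e0; have e2 : 0 < e / 2 by rewrite divr_gt0.
near=> n => p p01 p_le; have /andP[p0 _] := p01.
have n_gt1 : (1 < n)%N by near: n; exact: nbhs_infty_gt.
have n_gt0 : (0 < n)%N by apply: ltnW.
have n0 : 0 < n%:R :> R by rewrite ltr0n.
have n1 : 1 <= n%:R :> R by rewrite ler1n.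
have ln1 : 1 <= ln n%:R :> R.
  rewrite -[leLHS]expRK ler_ln ?posrE ?expR_gt0 //.
  by near: n; exact: nbhs_infty_ger.
(* The index [None] stands for too many vertices of degree at least 3, and [Some M] for the
   existence of many words of [M] links. The bound 90 is 3/5 of 150. *)
pose T := option 'I_(n.+1 * (n * n)).+1.
pose D (t : T) := if t is Some M then 90 * ln n%:R <= M%:R :> R else true.
pose P (t : T) (G : sgraph 'I_n) := if t is Some M
  then (2 ^ M * M`! <=
     #|[set t : witness M | admissible t & (witness_edges t \subset edges G)]|)%N
  else (n < 9 * #|[set v | 3 <= #|nbrs G v|]|)%N.
apply: le_trans (gnp_pr_union _ D P _ _ p01 _) _.
  move=> G [S S_large rig].
  have [deg3|] := leqP (9 * #|[set v | 3 <= #|nbrs G v|]%N|) n; last by exists None.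
  have S4 : (4 <= #|S|)%N by rewrite -(ler_nat R); lra.
  have [M [SM Mn wit]] := rigid_witnesses G S S4 rig deg3.
  exists (Some (Ordinal (Mn : M < _.+1)%N)) => //=.
  have : 3 * #|S|%:R <= 5 * M%:R :> R by rewrite -!natrM ler_nat.
  by lra.
rewrite (bigD1 None) //= (_ : e = e / 2 + e / 2); last by lra.
apply: lerD.
  by move: p p0 p_le {p01}; near: n; apply: many_high_degree_near.
(* Using [M <= 100 * expR (M / 100)], the exponent becomes [- 0.066 * M], at most [- 5.94 * ln n].
   Fewer than [2 * n ^ 3] such terms leave a total of order [n ^- 2]. *)
have one_term t : D t && (t != None) ->
    gnp_pr p (P t) <= 100 * expR 1 * n%:R ^- 5.
  case: t => [[M /= _]|]; last by rewrite andbF.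
  rewrite andbT => M_large.
  have M_gt0 : (0 < M)%N by rewrite -(ltr0n R); lra.
  apply: le_trans (many_witnesses_pr n_gt0 M_gt0 p p01 p_le) _.
  rewrite -[leLHS]mulrA [100 * _]mulrC -[leRHS]mulrA ler_wpM2l ?expR_ge0 //.
  apply: le_trans (_ : 100 * expR (1 / 100 * M%:R) * expR (- (19 / 250 * M%:R)) <= _).
    rewrite ler_wpM2r ?expR_ge0 //.
    by have := expR_ge1Dx (1 / 100 * M%:R : R); lra.
  rewrite -mulrA ler_wpM2l // -expRD.
  rewrite -[n%:R]lnK ?posrE // -expRM_natl -expRN ler_expR.
  by lra.
apply: le_trans (ler_sum _ one_term) _.
rewrite sumr_const -[leLHS]mulr_natl.
apply: le_trans (_ : (2 * n ^ 3)%:R * (100 * expR 1 * n%:R ^- 5) <= _).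
  rewrite ler_wpM2r ?mulr_ge0 ?expR_ge0 ?invr_ge0 ?exprn_ge0 // ler_nat.
  apply: (@leq_trans #|[pred t : T | t != None]|).
    by apply: subset_leq_card; apply/fintype.subsetP => t; rewrite !inE => /andP[].
  rewrite cardC1 card_option card_ord /=.
  by nia.
have -> : (2 * n ^ 3)%:R * (100 * expR 1 * n%:R ^- 5) = 200 * expR 1 / n%:R ^+ 2 :> R.
  by rewrite natrM natrX; field; rewrite lt0r_neq0.
rewrite ler_pdivrMr ?exprn_gt0 //.
have : 200 * expR 1 / (e / 2) <= n%:R by near: n; exact: nbhs_infty_ger.
rewrite ler_pdivrMr // => /le_trans; apply.
by rewrite mulrC ler_wpM2l ?(ltW e2) // expr2 ler_peMl.
Unshelve. all: by end_near. Qed.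

Local Open Scope classical_set_scope.
Local Open Scope ring_scope.

Theorem theorem1p5 (R : realType) :
  exists2 gamma : R, 0 < gamma &
    forall p : nat -> R,
      (forall n : nat, (0 < n)%N -> 0 <= p n <= 1) ->
      (forall n : nat, (0 < n)%N -> p n < (11 / 10) / n%:R) ->
      (fun n : nat =>
         gnp_pr (p n) (fun G : sgraph 'I_n =>
           forall V' : {set 'I_n}, gamma * ln n%:R <= #|V'|%:R ->
             ~ globally_rigid R (induced_subgraph G V'))) @ \oo --> (1 : R).
Proof.
exists 150 => // p p01 p_lt; apply/cvgrPdist_le => e e0; near=> n.
have n_gt0 : (0 < n)%N by near: n; exact: nbhs_infty_gt.
rewrite gnp_prC subKr ger0_norm ?gnp_pr_ge0 ?p01 //.
apply: le_trans (_ : gnp_pr (p n) (fun G : sgraph 'I_n =>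
    exists2 S : {set 'I_n}, 150 * ln (n%:R : R) <= #|S|%:R &
    globally_rigid R (induced_subgraph G S)) <= _).
  apply: gnp_pr_le; rewrite ?p01 // => G.
  by move=> /existsNP[S /not_implyP[S_large /contrapT rig]]; exists S.
have := p01 n n_gt0; have := ltW (p_lt n n_gt0).
(* The threshold on [n] must not depend on the edge probability, so [p n] is replaced by an
   arbitrary [q] before the eventual bound is used. *)
move: (p n) => q q_le q01; move: q q01 q_le.
by near: n; apply: rigid_subset_near.
Unshelve. all: by end_near. Qed.
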